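(* Let $I=(-1,1)$. There exists a bounded potential $V:I\to\mathbb{R}$ such that the second eigenfunction of the Dirichlet eigenvalue problem $$((-\Delta)^{1/2}+V(x))u(x)=\lambda u(x)\ \ (x\in I),\qquad u(x)=0\ \ (x\in\mathbb{R}\setminus I)$$ has at least two sign changes. That is, if $\lambda_1<\lambda_2\le\lambda_3\le\dots$ are the eigenvalues of this problem counted with multiplicity and $u$ is an eigenfunction for $\lambda_2$ (taken in its continuous representative), then, after possibly replacing $u$ by $-u$, there are points $y_1<y_2<y_3$ in $I$ with $u(y_1)<0$, $u(y_2)>0$, $u(y_3)<0$.
   Context: For $s\in(0,1)$, $H^s(\mathbb{R})$ is the fractional Sobolev space of $u\in L^2(\mathbb{R})$ with $[u]^2_{H^s(\mathbb{R})}=\int_{\mathbb{R}}\int_{\mathbb{R}}\frac{|u(x)-u(y)|^2}{|x-y|^{1+2s}}\,dx\,dy<\infty$, and for an open bounded $\Omega\subset\mathbb{R}$, $H^s_0(\Omega)=\{u\in H^s(\mathbb{R}):u=0\text{ a.e. on }\mathbb{R}\setminus\Omega\}$. Let $c_s>0$ be the standard normalising constant of the one-dimensional fractional Laplacian $(-\Delta)^s$ and $$\mathcal{E}_{\mathrm{res}}[u,v]=\frac{c_s}{2}\iint_{\mathbb{R}\times\mathbb{R}}\frac{(u(x)-u(y))(v(x)-v(y))}{|x-y|^{1+2s}}\,dx\,dy .$$ With $s=1/2$ and $\Omega=I$, a real number $\lambda$ is an eigenvalue with eigenfunction $u\in H^{1/2}_0(I)\setminus\{0\}$ if $\mathcal{E}_{\mathrm{res}}[u,w]+\int_I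 Vuw\,dx=\lambda\int_I uw\,dx$ for every $w\in H^{1/2}_0(I)$. The eigenvalues form a sequence $\lambda_1<\lambda_2\le\lambda_3\le\dots$ tending to infinity (listed with multiplicity), and eigenfunctions have representatives that are (Hölder) continuous on $\mathbb{R}$. *)

(* Defs.v *)
From HB Require Import structures.
From mathcomp Require Import all_boot all_order all_algebra.
From mathcomp Require Import all_classical all_reals all_analysis.

Set Implicit Arguments.
Unset Strict Implicit.
Unset Printing Implicit Defensive.
Import Order.TTheory GRing.Theory Num.Theory.
Import numFieldNormedType.Exports.

Local Open Scope classical_set_scope.
Local Open Scope ring_scope.

Notation leb R := (@lebesgue_measure R).

Definition ae_zero (R : realType) (u : R -> R) : Prop :=
  {ae leb R, forall x, u x = 0}.

(* Integrand of the Gagliardo form.  On the diagonal, a null set, the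
   denominator vanishes and so does the quotient. *)
Definition gagliardo (R : realType) (s : R) (u v : R -> R) (z : R * R) : R :=
  (u z.1 - u z.2) * (v z.1 - v z.2) / `|z.1 - z.2| `^ (1 + 2 * s).

(* Elements of H^s are functions, not classes: equality almost everywhere is
   spelled out wherever it matters. *)
Definition Hs (R : realType) (s : R) : set (R -> R) :=
  [set u | u \in Lfun (leb R) 2%:E /\
    (\int[(leb R \x leb R)%E]_z (gagliardo s u u z)%:E < +oo)%E].

Definition Hs0 (R : realType) (s : R) (Omega : set R) : set (R -> R) :=
  [set u | Hs s u /\ {ae leb R, forall x, ~ Omega x -> u x = 0}].

(* The normalisation for which (-Delta)^s has Fourier symbol |xi|^(2s);
   equal to 1 / pi when s = 1/2. *)
Definition c_frac (R : realType) (s : R) : R :=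
  (\int[leb R]_t ((1 - cos t) / `|t| `^ (1 + 2 * s)))^-1.

Definition E_res (R : realType) (s : R) (u v : R -> R) : R :=
  c_frac s / 2 * \int[(leb R \x leb R)%E]_z gagliardo s u v z.

(* V is only used on Omega. *)
Definition frac_eigenspace (R : realType) (s : R) (Omega : set R) (V : R -> R)
    (lambda : R) : set (R -> R) :=
  [set u | Hs0 s Omega u /\
    forall w, Hs0 s Omega w ->
      E_res s u w + \int[leb R]_(x in Omega) (V x * u x * w x) =
      lambda * \int[leb R]_(x in Omega) (u x * w x)].

Definition frac_eigenfunction (R : realType) (s : R) (Omega : set R) (V : R -> R)
    (lambda : R) (u : R -> R) : Prop :=
  frac_eigenspace s Omega V lambda u /\ ~ ae_zero u.

(* E, taken modulo equality almost everywhere, has a basis of n elements. *)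
Definition ae_dim (R : realType) (E : set (R -> R)) (n : nat) : Prop :=
  exists e : 'I_n -> R -> R,
    [/\ forall i, E (e i),
        forall a : 'I_n -> R,
          ae_zero (fun x => \sum_(i < n) a i * e i x) -> forall i, a i = 0
      & forall u, E u -> exists a : 'I_n -> R,
          ae_zero (fun x => u x - \sum_(i < n) a i * e i x)].

(* lam lists the eigenvalues with multiplicity, lam 0 being the first one:
   each real number mu occurs in lam as many times as the dimension of its
   eigenspace (hence not at all if mu is not an eigenvalue). *)
Definition eigenvalue_sequence (R : realType) (s : R) (Omega : set R)
    (V : R -> R) (lam : nat -> R) : Prop :=
  [/\ lam 0%N < lam 1%N,
      {homo lam : m n / (m <= n)%N >-> m <= n},
      lam n @[n --> \oo] --> +oo
    & forall mu : R, exists2 n : nat,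
        ([set k | lam k = mu] #= `I_n)%card & ae_dim (frac_eigenspace s Omega V mu) n].

(* Main.v *)
Require Import Defs.
From HB Require Import structures.
From mathcomp Require Import all_boot all_order all_algebra.
From mathcomp Require Import all_classical all_reals all_analysis.
From mathcomp Require Import measurable_realfun ring lra.

(** The potential is V(x) = - c / max(|x|, e), where c is the normalising
constant of the half-Laplacian and e > 0 is small.  On the line the energy of
order 1/2 and the integral of w(x)^2 / |x| scale in the same way, but no
inequality controls the second by the first: for a cutoff between two radii
the energy stays bounded while the integral grows like the logarithm of the
ratio of the radii.  For odd functions the control does hold, with a constant
that V respects.  So V pushes even functions below zero and leaves odd ones
above.

- Odd functions have a nonnegative form ([hardy], [form_odd_ge0]).  As V is
  even, the odd part of an eigenfunction with negative eigenvalue must vanish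
  ([negative_even]).
- Two cutoffs with disjoint supports span a plane on which the form is negative
  definite, so for every f there is a negative direction orthogonal to f
  ([two_negative], [negative_orth]).
- The Rayleigh quotient attains its infimum, also on the orthogonal complement
  of an eigenfunction, and the minimiser is an eigenfunction ([minimiser],
  [spectral_minimum]).  Compactness of the embedding into L^2 enters as a bound
  of the L^2 norm by a small multiple of the energy and finitely many averages
  ([finite_rank]), which turns a minimising sequence into a Cauchy sequence of
  a complete space ([H12_complete]).  Taking first no constraint and then
  orthogonality to the first minimiser gives two eigenfunctions and shows that
  the second eigenvalue is negative ([second_negative]).  A second
  eigenfunction u is therefore even.
- Replacing the first minimiser by its absolute value p does not increase its
  form, so p is a nonnegative first eigenfunction and is orthogonal to u.  If u
  had one sign, then p u = 0 almost everywhere, and the nonlocal form of p and u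
  would reduce to a double integral of p(x) u(y) / (x - y)^2, which would have
  to vanish ([no_orthogonal_signed]).  So u takes both signs on the interval,
  and by evenness it changes sign on each side of the origin
  ([even_two_changes]). *)

Import Order.TTheory GRing.Theory Num.Theory.
Import numFieldNormedType.Exports.
Local Open Scope classical_set_scope.
Local Open Scope ring_scope.
Set Implicit Arguments.
Unset Strict Implicit.
Unset Printing Implicit Defensive.

(** * A scale-invariant kernel on the line *)

Section Line.
Context {R : realType}.
Local Notation mu := (@lebesgue_measure R).

Lemma ge0_integral_opp (f : R -> \bar R) : measurable_fun [set: R] f ->
  (forall x, 0 <= f x)%E -> (\int[mu]_x f (- x)%R = \int[mu]_x f x)%E.
Proof.
move=> mf f0.
apply/esym; transitivity
  (\int[mu]_(x in (-%R : _ -> measurableTypeR R) @^-1` setT) f (- x)%R)%E; last first.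
  by rewrite preimage_setT.
rewrite -ge0_integral_pushforward//=.
by apply: eq_measure_integral => A mA _; exact/esym/lebesgue_measureN.
Qed.

Lemma denom_gt0 (a x : R) : 0 < a -> 0 < a + `|x|.
Proof. by move=> a0; rewrite ltr_wpDr. Qed.

(** Its mass is 2 at every scale [a].  Taking [a = |x|] integrates out one
variable of the Hardy kernel, and a product of two such kernels dominates the
energy density of a cutoff at scale [a]. *)
Definition kap (a x : R) : R := a / (a + `|x|) ^+ 2.

Lemma kap_ge0 (a x : R) : 0 < a -> 0 <= kap a x.
Proof. by move=> a0; rewrite divr_ge0 ?exprn_ge0// ltW// denom_gt0. Qed.

Lemma continuous_kap (a : R) : 0 < a -> continuous (kap a).
Proof.
move=> a0 x; apply: cvgM; first exact: cvg_cst.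
apply: cvgV; first by rewrite gt_eqF// exprn_gt0// denom_gt0.
apply: (@continuous_comp _ _ _ (fun y => a + `|y|) (fun y => y ^+ 2)).
  by apply: cvgD; [exact: cvg_cst|exact: norm_continuous].
exact: exprn_continuous.
Qed.

Lemma measurable_kap (a : R) : 0 < a -> measurable_fun [set: R] (kap a).
Proof. by move=> a0; apply: continuous_measurable_fun; exact: continuous_kap. Qed.

Lemma integral_kap (a : R) : 0 < a -> (\int[mu]_x (kap a x)%:E = 2%:E)%E.
Proof.
move=> a0; rewrite ge0_symfun_integralT; last 3 first.
- by move=> x; exact: kap_ge0.
- exact: continuous_kap.
- by move=> x; rewrite /kap /= normrN.
suff -> : (\int[mu]_(x in [set x | (0 <= x)%R]) (kap a x)%:E = 1)%E by rewrite mule1.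
rewrite -set_itvcy.
rewrite (@ge0_continuous_FTC2y _ _ (fun x => - (a / (a + x))) 0 0).
- by rewrite sub0e addr0 divff ?gt_eqF// EFinN oppeK.
- by move=> x _; exact: kap_ge0.
- by apply: continuous_subspaceT; exact: continuous_kap.
- rewrite -oppr0; apply: cvgN; rewrite -(mulr0 a); apply: cvgM; first exact: cvg_cst.
  apply/gtr0_cvgV0; last exact: cvg_addrl.
  by near=> x; rewrite addr_gt0//; near: x; exact: nbhs_pinfty_gt.
- move=> x x0; apply: derivableN; apply: derivableM => //.
  by apply: derivableV => //; rewrite gt_eqF// addr_gt0.
- apply: cvg_at_right_filter; apply: cvgN; apply: cvgM; first exact: cvg_cst.
  apply: cvgV; first by rewrite addr0 gt_eqF.
  by apply: cvgD; [exact: cvg_cst|exact: cvg_id].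
- move=> x; rewrite in_itv/= andbT => x0.
  have ax0 : a + x != 0 by rewrite gt_eqF// addr_gt0.
  have dV : is_derive x 1 (fun y => (a + y)^-1) (- (a + x) ^- 2 *: 1).
    by apply: is_deriveV => //; apply: is_derive_eq; rewrite add0r.
  rewrite derive1E; apply: derive_val.
  rewrite (_ : (fun y => - (a / (a + y))) = (- a) \*: (fun y => (a + y)^-1)); last first.
    by apply/funext => y /=; rewrite /GRing.scale/= mulNr.
  apply: is_derive_eq; rewrite /kap ger0_norm ?ltW// /GRing.scale/=.
  by field.
Unshelve. all: by end_near. Qed.

End Line.

(** * The kernel and the normalising constant for s = 1/2 *)

Section Kernel.
Context {R : realType}.
Local Notation mu := (@lebesgue_measure R).

Lemma powR_half (t : R) : `|t| `^ (1 + 2 * 2^-1) = t ^+ 2.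
Proof.
rewrite divff ?pnatr_eq0// (_ : 1 + 1 = 2%:R :> R)//.
by rewrite powR_mulrn// real_normK ?num_real.
Qed.

Lemma measurable_sqV : measurable_fun [set: R] (fun t : R => (t ^+ 2)^-1).
Proof.
rewrite (_ : (fun t => _) = (fun t : R => `|t| `^ (- 2))).
  by apply: measurableT_comp (@measurable_powR R _) _; exact: normr_measurable.
by apply/funext => t; rewrite powRN powR_mulrn// real_normK ?num_real.
Qed.

Lemma one_sub_cos_le (t : R) : 1 - cos t <= t ^+ 2.
Proof.
wlog t0 : t / 0 <= t => [h|].
  have [/h//|/ltW t0] := leP 0 t.
  by rewrite -cosN -sqrrN; apply: h; rewrite oppr_ge0.
have sinle (x : R) : 0 <= x -> sin x <= x.
  move=> x0; have [y yx] := MVT_segment x0 (fun x _ => is_derive_sin x)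
    (continuous_subspaceT (@continuous_sin R)).
  by rewrite sin0 !subr0 => ->; rewrite ler_piMl// cos_le1.
have [y] := MVT_segment t0 (fun x _ => is_derive_cos x)
    (continuous_subspaceT (@continuous_cos R)).
rewrite in_itv/= => /andP[y0 yt]; rewrite cos0 subr0 => h.
have := sinle _ y0; have : (sin y) * t <= t * t.
  by rewrite ler_wpM2r// (le_trans (sinle _ _)).
by rewrite expr2; lra.
Qed.

Let f (t : R) : R := (1 - cos t) / `|t| `^ (1 + 2 * 2^-1).

Let f_ge0 t : 0 <= f t.
Proof. by rewrite /f divr_ge0 ?powR_ge0// subr_ge0 cos_le1. Qed.

Let f_le t : f t <= 8 * kap 1 t.
Proof.
rewrite /f powR_half /kap mul1r -real_normK ?num_real//.
have [->|t0] := eqVneq t 0; first by rewrite normr0 expr0n invr0 mulr0 divr_ge0// sqr_ge0.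
have n0 : 0 < `|t| by rewrite normr_gt0.
have := one_sub_cos_le t; rewrite -real_normK ?num_real// => h1.
have h2 : 1 - cos t <= 2 by have := cos_geN1 t; lra.
rewrite ler_pdivrMr ?exprn_gt0// mulrAC ler_pdivlMr ?exprn_gt0 ?addr_gt0//.
have h0 : 0 <= 1 - cos t by rewrite subr_ge0 cos_le1.
move: (1 - cos t) `|t| n0 h0 h1 h2 => c s s0 c0 cs c2.
have [s1|s1] := leP s 1.
  have : (1 + s) ^+ 2 <= 4 by nra.
  by have := sqr_ge0 s; nra.
have : (1 + s) ^+ 2 <= 4 * s ^+ 2 by nra.
have := sqr_ge0 (1 + s); nra.
Qed.

Let mf : measurable_fun [set: R] f.
Proof.
rewrite /f; under eq_fun do rewrite powR_half.
apply: measurable_funM; last exact: measurable_sqV.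
apply: measurable_funB; first exact: measurable_cst.
by apply: continuous_measurable_fun; exact: continuous_cos.
Qed.

Let f_fin : (\int[mu]_x (f x)%:E < +oo)%E.
Proof.
apply: (@le_lt_trans _ _ (\int[mu]_x (8%:E * (kap 1 x)%:E))%E).
  apply: ge0_le_integral => //=.
  - by move=> x _; rewrite lee_fin.
  - exact/measurable_EFinP.
  - by apply/measurable_EFinP; apply: measurable_funM => //; exact: measurable_kap.
  - by move=> x _; rewrite -EFinM lee_fin.
rewrite ge0_integralZl_EFin//; last 2 first.
  - by move=> x _; rewrite lee_fin kap_ge0.
  - by apply/measurable_EFinP; exact: measurable_kap.
by rewrite integral_kap// -EFinM ltry.
Qed.

(** Needs both finiteness of the defining integral, since the inverse of an
infinite integral is 0 by convention, and its positivity.  The integrand is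
dominated by [8 * kap 1]: near 0 by [1 - cos t <= t ^+ 2], away from 0 by
[1 - cos t <= 2], and [(1 + t) ^+ 2] is at most [4] or [4 * t ^+ 2]. *)
Lemma c_frac_gt0 : 0 < c_frac (2^-1 : R).
Proof.
rewrite /c_frac invr_gt0 /Rintegral -/f.
have int0 : (0 <= \int[mu]_x (f x)%:E)%E.
  by apply: integral_ge0 => x _; rewrite lee_fin.
apply: fine_gt0; rewrite lt_neqAle int0 f_fin andbT eq_sym andbT.
apply/eqP => f0.
have : ae_eq mu setT (EFin \o f) (cst 0%E).
  apply/ae_eq_integral_abs => //; first exact/measurable_EFinP.
  by under eq_integral do rewrite gee0_abs ?lee_fin//.
move=> [N [mN muN0 subN]].
have : (mu `]0%R, 1%R[ <= mu N)%E.
  apply: le_measure; rewrite ?inE//=.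
  apply: subset_trans subN => t /=; rewrite in_itv/= => /andP[t0 t1].
  apply/not_implyP; split => //; case => /eqP; rewrite gt_eqF// /f.
  rewrite divr_gt0 ?powR_gt0 ?normr_gt0 ?gt_eqF// subr_gt0 -cos0 ltr_cos//.
    by rewrite in_itv/= lexx pi_ge0.
  by rewrite in_itv/= ltW//= (le_trans (ltW t1))// (le_trans _ (pi_ge2 R))// ler1n.
have m01 : leb R `]0%R, 1%R[%classic = 1%E.
  by rewrite lebesgue_measure_itv/= lte_fin ltr01 oppr0 adde0.
by rewrite muN0 [X in (X <= _)%E]m01 leNgt lte_fin ltr01.
Qed.

End Kernel.

(** * The space and its bilinear forms *)

(** The form domain of the problem on the interval. *)
Notation H12 R := (Hs0 (2^-1 : R) `]-1, 1[).

Section Space.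
Context {R : realType}.
Implicit Types (u v w V : R -> R) (a b : R).
Local Notation mu := (@lebesgue_measure R).
Local Notation mu2 := (leb R \x leb R)%E.
Let I := (`]-1, 1[ : set R).

Definition gag u v (z : R * R) : R := gagliardo 2^-1 u v z.

Lemma gagE u v z :
  gag u v z = (u z.1 - u z.2) * (v z.1 - v z.2) * ((z.1 - z.2) ^+ 2)^-1.
Proof. by rewrite /gag /gagliardo powR_half. Qed.

Lemma gag_ge0 u z : 0 <= gag u u z.
Proof. by rewrite gagE mulr_ge0// ?invr_ge0 ?sqr_ge0// -expr2 sqr_ge0. Qed.

Lemma measurable_gag u v : measurable_fun [set: R] u ->
  measurable_fun [set: R] v -> measurable_fun [set: R * R] (gag u v).
Proof.
move=> mu_ mv; rewrite (funext (gagE u v)).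
apply: measurable_funM; first apply: measurable_funM.
- apply: measurable_funB; apply: measurableT_comp => //.
- apply: measurable_funB; apply: measurableT_comp => //.
exact: (measurableT_comp measurable_sqV
  (measurable_funB measurable_fst measurable_snd)).
Qed.

(** The Gagliardo energy with value in the extended reals, used as long as
finiteness is not known. *)
Definition energy u : \bar R := (\int[mu2]_z (gag u u z)%:E)%E.

Definition L2sq u : \bar R := (\int[mu]_x (u x ^+ 2)%:E)%E.

Definition zero_off_I u := {ae mu, forall x, ~ I x -> u x = 0}.

Lemma H12P u : H12 R u <->
  [/\ measurable_fun [set: R] u, (L2sq u < +oo)%E, (energy u < +oo)%E & zero_off_I u].
Proof.
split.
  move=> [[L2 E] ou]; split => //.
    by move: L2; rewrite inE => /andP[/[!inE]].
  exact: (integrable_lty _ (Lfun2_integrable_sqr L2)).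
move=> [mu_ L2 E ou]; split => //; split => //.
rewrite inE; apply/andP; split; first by rewrite inE.
rewrite inE/= /finite_norm unlock /= poweR_lty//.
rewrite (_ : (\int[_]_x _)%E = L2sq u)//; apply: eq_integral => x _.
by rewrite /= powR_mulrn// real_normK ?num_real.
Qed.

Lemma ae_filter : Filter (almost_everywhere mu).
Proof. exact: (@ae_filter_ringOfSetsType _ _ _ (leb R)). Qed.

(** All linear combinations are written in this one shape, so that one lemma per
form covers sums, differences and multiples. *)
Definition lin a u b v : R -> R := fun x => a * u x + b * v x.

Lemma gag_le u v z : `|gag u v z| <= gag u u z + gag v v z.
Proof.
rewrite !gagE -mulrDl normrM [X in _ * X <= _]ger0_norm ?invr_ge0 ?sqr_ge0//.
rewrite ler_wpM2r ?invr_ge0 ?sqr_ge0//.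
move: (u z.1 - u z.2) (v z.1 - v z.2) => p q.
have := sqr_ge0 (p + q); have := sqr_ge0 (p - q); have := sqr_ge0 p.
by have := sqr_ge0 q; rewrite ler_norml; nra.
Qed.

Lemma gag_lin_le a u b v z : gag (lin a u b v) (lin a u b v) z <=
  (2 * a ^+ 2) * gag u u z + (2 * b ^+ 2) * gag v v z.
Proof.
rewrite !gagE !mulrA -mulrDl ler_wpM2r ?invr_ge0 ?sqr_ge0// /lin.
rewrite -subr_ge0.
rewrite [leRHS](_ : _ = (a * (u z.1 - u z.2) - b * (v z.1 - v z.2)) ^+ 2); last ring.
exact: sqr_ge0.
Qed.

Lemma measurable_lin a u b v : measurable_fun [set: R] u ->
  measurable_fun [set: R] v -> measurable_fun [set: R] (lin a u b v).
Proof.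
by move=> mu_ mv; apply: measurable_funD; apply: measurable_funM => //;
  exact: measurable_cst.
Qed.

Lemma ge0_integral_lin d (T : measurableType d) (m : {measure set T -> \bar R})
    (f g : T -> R) a b :
  measurable_fun setT f -> measurable_fun setT g ->
  (forall x, 0 <= f x) -> (forall x, 0 <= g x) -> 0 <= a -> 0 <= b ->
  (\int[m]_x (a * f x + b * g x)%:E =
   a%:E * \int[m]_x (f x)%:E + b%:E * \int[m]_x (g x)%:E)%E.
Proof.
move=> mf mg f0 g0 a0 b0.
under eq_integral do rewrite EFinD !EFinM.
rewrite ge0_integralD//.
- rewrite !ge0_integralZl_EFin//; try (by move=> x _; rewrite lee_fin);
    exact/measurable_EFinP.
- by move=> x _; rewrite -EFinM lee_fin mulr_ge0.
- by under eq_fun do rewrite -EFinM; apply/measurable_EFinP/measurable_funM.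
- by move=> x _; rewrite -EFinM lee_fin mulr_ge0.
- by under eq_fun do rewrite -EFinM; apply/measurable_EFinP/measurable_funM.
Qed.

Lemma energy_lin_le a u b v : measurable_fun [set: R] u ->
  measurable_fun [set: R] v ->
  (energy (lin a u b v) <= (2 * a ^+ 2)%:E * energy u + (2 * b ^+ 2)%:E * energy v)%E.
Proof.
move=> mu_ mv; have ml := measurable_lin a b mu_ mv.
rewrite -ge0_integral_lin//; try exact: measurable_gag; try exact: gag_ge0;
  try by rewrite mulr_ge0// sqr_ge0.
apply: ge0_le_integral => //=.
- by move=> z _; rewrite lee_fin gag_ge0.
- by apply/measurable_EFinP; exact: measurable_gag.
- by apply/measurable_EFinP; apply: measurable_funD; apply: measurable_funM => //;
    exact: measurable_gag.
- by move=> z _; rewrite lee_fin gag_lin_le.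
Qed.

Lemma L2sq_lin_le a u b v : measurable_fun [set: R] u ->
  measurable_fun [set: R] v ->
  (L2sq (lin a u b v) <= (2 * a ^+ 2)%:E * L2sq u + (2 * b ^+ 2)%:E * L2sq v)%E.
Proof.
move=> mu_ mv; have ml := measurable_lin a b mu_ mv.
rewrite -ge0_integral_lin//; try (by move=> x; exact: sqr_ge0);
  try by rewrite mulr_ge0// sqr_ge0.
2-3: exact: measurable_funX.
apply: ge0_le_integral => //=.
- by move=> z _; rewrite lee_fin sqr_ge0.
- by apply/measurable_EFinP; exact: measurable_funX.
- by apply/measurable_EFinP; apply: measurable_funD; apply: measurable_funM => //;
    exact: measurable_funX.
- by move=> z _; rewrite lee_fin /lin; have := sqr_ge0 (a * u z - b * v z); nra.
Qed.

Lemma H12_lin a u b v : H12 R u -> H12 R v -> H12 R (lin a u b v).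
Proof.
move=> /H12P[mu_ lu eu ou] /H12P[mv lv ev ov]; apply/H12P; split.
- exact: measurable_lin.
- apply: le_lt_trans (L2sq_lin_le _ _ mu_ mv) _.
  have ? : (0 <= L2sq u)%E by apply: integral_ge0 => x _; rewrite lee_fin sqr_ge0.
  have ? : (0 <= L2sq v)%E by apply: integral_ge0 => x _; rewrite lee_fin sqr_ge0.
  by rewrite lte_add_pinfty//; apply: lte_mul_pinfty => //; rewrite lee_fin mulr_ge0 ?sqr_ge0.
- apply: le_lt_trans (energy_lin_le _ _ mu_ mv) _.
  have ? : (0 <= energy u)%E by apply: integral_ge0 => x _; rewrite lee_fin gag_ge0.
  have ? : (0 <= energy v)%E by apply: integral_ge0 => x _; rewrite lee_fin gag_ge0.
  by rewrite lte_add_pinfty//; apply: lte_mul_pinfty => //; rewrite lee_fin mulr_ge0 ?sqr_ge0.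
- apply: (@filterS2 _ _ ae_filter _ _ _ _ ou ov) => x hu hv nx.
  by rewrite /lin hu// hv// !mulr0 addr0.
Qed.

(** [Gf], [dot] and [pot V] are the Gagliardo form, the L^2 product and the
potential term; without the constant in front of [Gf] these are the three
ingredients of the weak equation. *)
Definition Gf u v := \int[mu2]_z gag u v z.
Definition dot u v := \int[mu]_(x in I) (u x * v x).
Definition pot V u v := \int[mu]_(x in I) (V x * u x * v x).

Lemma gag_int u v : H12 R u -> H12 R v -> mu2.-integrable setT (EFin \o gag u v).
Proof.
move=> /H12P[mu_ lu eu ou] /H12P[mv lv ev ov].
have ii w : measurable_fun setT w -> (energy w < +oo)%E ->
    mu2.-integrable setT (EFin \o gag w w).
  move=> mw ew; apply/integrableP; split.
    by apply/measurable_EFinP; exact: measurable_gag.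
  by under eq_integral do rewrite gee0_abs ?lee_fin ?gag_ge0//.
apply: (le_integrable _ _ _ (integrableD _ (ii _ mu_ eu) (ii _ mv ev))) => //.
- by apply/measurable_EFinP; exact: measurable_gag.
- move=> z _; rewrite -[leRHS]/(`|(gag u u z + gag v v z)%:E|)%E lee_fin.
  rewrite (le_trans (gag_le _ _ _))//.
  by rewrite ler_norm.
Qed.

Lemma mI : measurable (I : set (measurableTypeR R)). Proof. exact: measurable_itv. Qed.

Lemma dot_int u v : H12 R u -> H12 R v ->
  mu.-integrable I (fun x => (u x * v x)%:E).
Proof.
move=> [[Lu _] _] [[Lv _] _].
apply: (@integrableS _ _ _ _ setT) => //; first exact: mI.
exact: (Lfun1_integrable _ _).1 (Lfun2_mul_Lfun1 Lu Lv).
Qed.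

Definition bounded_potential V := measurable_fun I V /\ exists M : R, forall x, I x -> `|V x| <= M.

Lemma pot_int V u v : bounded_potential V -> H12 R u -> H12 R v ->
  mu.-integrable I (fun x => (V x * u x * v x)%:E).
Proof.
move=> [mV [M VM]] Hu Hv; under eq_fun do rewrite -mulrA EFinM.
have bV : [bounded V x | x in I].
  by exists M; split => [|x Mx y Iy]; [exact: num_real|exact: le_trans (VM _ Iy) (ltW Mx)].
have := @integrableMr _ _ _ mu I mI V (fun x => (u x * v x)%:E) mV bV (dot_int Hu Hv).
by [].
Qed.

Lemma Gf_sym u v : Gf u v = Gf v u.
Proof.
by apply: eq_Rintegral => z _; rewrite !gagE [X in X / _]mulrC.
Qed.

Lemma dot_sym u v : dot u v = dot v u.
Proof. by apply: eq_Rintegral => z _; rewrite mulrC. Qed.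

Lemma pot_sym V u v : pot V u v = pot V v u.
Proof. by apply: eq_Rintegral => z _; rewrite mulrAC. Qed.

Lemma Rintegral_lin d (T : measurableType d) (m : {measure set T -> \bar R})
    (D : set T) (f g : T -> R) a b : measurable D ->
  m.-integrable D (EFin \o f) -> m.-integrable D (EFin \o g) ->
  \int[m]_(x in D) (a * f x + b * g x) =
  a * \int[m]_(x in D) f x + b * \int[m]_(x in D) g x.
Proof.
move=> mD mf mg; rewrite RintegralD//.
- by rewrite !RintegralZl.
- exact: (integrableZl mD a mf).
- exact: (integrableZl mD b mg).
Qed.

Lemma Gf_lin a u b v w : H12 R u -> H12 R v -> H12 R w ->
  Gf (lin a u b v) w = a * Gf u w + b * Gf v w.
Proof.
move=> Hu Hv Hw; rewrite -Rintegral_lin//; try exact: gag_int.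
by apply: eq_Rintegral => z _; rewrite !gagE /lin; ring.
Qed.

Lemma dot_lin a u b v w : H12 R u -> H12 R v -> H12 R w ->
  dot (lin a u b v) w = a * dot u w + b * dot v w.
Proof.
move=> Hu Hv Hw; rewrite -Rintegral_lin//; try exact: dot_int; last exact: mI.
by apply: eq_Rintegral => z _; rewrite /lin; ring.
Qed.

Lemma pot_lin V a u b v w : bounded_potential V -> H12 R u -> H12 R v -> H12 R w ->
  pot V (lin a u b v) w = a * pot V u w + b * pot V v w.
Proof.
move=> bV Hu Hv Hw; rewrite -Rintegral_lin//; try exact: pot_int; last exact: mI.
by apply: eq_Rintegral => z _; rewrite /lin; ring.
Qed.

End Space.

(** * Completeness *)

Section Completeness.
Context {R : realType}.
Implicit Types (u v w : R -> R).
Local Notation mu := (@lebesgue_measure R).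
Local Notation mu2 := (leb R \x leb R)%E.
Local Notation I := (`]-1, 1[%classic : set R).

Lemma L2sq_dot u : H12 R u -> (dot u u)%:E = L2sq u.
Proof.
move=> Hu; have [mu_ L2 _ ou] := (H12P u).1 Hu.
have mI := @mI R.
have mu2_ : measurable_fun [set: R] (fun x => (u x ^+ 2)%:E).
  by apply/measurable_EFinP; exact: measurable_funX.
rewrite /dot /Rintegral fineK; last exact: (integrable_fin_num _ (dot_int Hu Hu)).
rewrite [LHS]integral_mkcond /L2sq.
apply: (@ge0_ae_eq_integral _ _ R mu setT _ (fun x => (u x ^+ 2)%:E)) => //=.
- apply/(measurable_restrictT _ mI)/(@measurable_funS _ _ _ _ setT) => //.
- by move=> x _; rewrite patchE; case: ifP => // _; rewrite lee_fin -expr2 sqr_ge0.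
- by move=> x _; rewrite lee_fin sqr_ge0.
- apply: (@filterS _ _ ae_filter _ _ _ ou) => x hx _; rewrite patchE.
  case: ifPn => [_|]; first by rewrite expr2.
  by rewrite notin_setE => /hx ->; rewrite expr0n.
Qed.

Lemma Gf_energy u : H12 R u -> (Gf u u)%:E = energy u.
Proof.
move=> Hu; rewrite /Gf /Rintegral fineK//.
exact: (integrable_fin_num _ (gag_int Hu Hu)).
Qed.

Lemma dot_ge0 u : 0 <= dot u u.
Proof. by apply: Rintegral_ge0 => x _; rewrite -expr2 sqr_ge0. Qed.

Lemma Gf_ge0 u : 0 <= Gf u u.
Proof. by apply: Rintegral_ge0 => x _; exact: gag_ge0. Qed.

(** Nonnegative functions converging almost everywhere inherit eventual bounds
of their integrals.  Applied to differences [v j - v k] with [k] fixed, it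
passes Cauchy estimates to the limit in [j]. *)
Lemma fatou_bound d (T : measurableType d) (m : {measure set T -> \bar R})
    (f : nat -> T -> R) (g : T -> R) (K : \bar R) (N : nat) :
  (forall n, measurable_fun setT (f n)) -> measurable_fun setT g ->
  (forall n x, 0 <= f n x) -> (forall x, 0 <= g x) ->
  (\forall x \ae m, f n x @[n --> \oo] --> g x) ->
  (forall n, (N <= n)%N -> (\int[m]_x (f n x)%:E <= K)%E) ->
  (\int[m]_x (g x)%:E <= K)%E.
Proof.
move=> mf mg f0 g0 fg fK.
have mfE n : measurable_fun setT (EFin \o f n) by exact/measurable_EFinP.
have F : Filter (almost_everywhere m) by exact: ae_filter_ringOfSetsType.
have -> : (\int[m]_x (g x)%:E = \int[m]_x limn_einf (fun n => (f n x)%:E))%E.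
  apply: ge0_ae_eq_integral => //.
  - exact/measurable_EFinP.
  - have -> : (fun x => limn_einf (fun n => (f n x)%:E)) =
       (fun x => - limn_esup (fun n => - (f n x)%:E))%E by [].
    apply: measurableT_comp => //.
    apply: (@measurable_fun_limn_esup _ _ _ _ (fun n x => - (f n x)%:E)%E) => n.
    exact: measurableT_comp (mfE n).
  - by move=> x _; rewrite lee_fin.
  - move=> x _; rewrite limn_einf_lim; apply: lime_ge; first exact: is_cvg_einfs.
    apply: nearW => n; apply: le_ereal_inf_tmp => _ [k _ <-].
    by rewrite lee_fin.
  - apply: filterS fg => x fgx _; apply/esym.
    suff /cvg_limn_einf_sup[-> _] : (f n x)%:E @[n --> \oo] --> (g x)%:E by [].
    by apply: cvg_EFin => //; exact: nearW.
have fE0 n x : setT x -> (0 <= (f n x)%:E)%E by rewrite lee_fin.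
apply: le_trans (@fatou _ _ R m setT measurableT (fun n x => (f n x)%:E) mfE fE0) _.
rewrite limn_einf_lim; apply: lime_le; first exact: is_cvg_einfs.
apply: nearW => n; apply: le_trans (fK (maxn n N) (leq_maxr _ _)).
by apply: ereal_inf_lbound; exists (maxn n N) => //=; exact: leq_maxl.
Qed.

Lemma ae_prod (P : R -> Prop) : {ae mu, forall x, P x} ->
  \forall z \ae mu2, P z.1 /\ P z.2.
Proof.
move=> [N [mN N0 PN]].
exists (N `*` setT `|` setT `*` N); split.
- by apply: measurableU; apply: measurableX.
- apply/eqP; rewrite -measure_le0.
  apply: le_trans (measureU2 _ _ _) _; try exact: measurableX.
  have e1 : ((mu \x mu) (N `*` setT) = 0 * mu setT)%E.
    exact: etrans (product_measure1E _ _ mN measurableT) (congr1 (mule^~ _) N0).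
  have e2 : ((mu \x mu) (setT `*` N) = mu setT * 0)%E.
    exact: etrans (product_measure1E _ _ measurableT mN) (congr1 (mule _) N0).
  rewrite [X in (X + _ <= _)%E]e1 [X in (_ + X <= _)%E]e2.
  by rewrite mul0e mule0 adde0.
- move=> z /= /not_andP[nP|nP]; [left|right]; split => //; exact: PN.
Qed.

Lemma measure_I : mu I = 2%:E.
Proof.
by rewrite lebesgue_measure_itv/= lte_fin gtrN// -EFinD opprK.
Qed.

(** By [2 * |f| <= 1 / e + e * f ^+ 2] with [e = 2 ^+ k], a squared norm of order
[4 ^- k] makes the integral of [|f|] of order [2 ^- k]; the stated constant is
in the shape of a summable geometric sequence. *)
Lemma integral_abs_le (f : R -> R) (k : nat) (C : R) :
  measurable_fun I f -> (\int[mu]_(x in I) (f x * f x)%:E <= (C / 4 ^+ k)%:E)%E ->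
  (\int[mu]_(x in I) (`|f x|)%:E <= ((2 * (2 + C)) / (2 ^ k.+1)%:R)%:E)%E.
Proof.
move=> mf fC; pose e : R := 2 ^+ k.
have e0 : 0 < e by rewrite exprn_gt0.
have mff : measurable_fun I (fun x => (f x * f x)%:E).
  by apply/measurable_EFinP; exact: measurable_funM.
apply: (@le_trans _ _ (\int[mu]_(x in I) ((e^-1)%:E + e%:E * (f x * f x)%:E))%E).
  apply: ge0_le_integral => //=.
  - by apply/measurable_EFinP; exact: measurableT_comp.
  - apply: emeasurable_funD; first exact: measurable_cst.
    exact: measurable_funeM.
  - move=> x _; rewrite -EFinM -EFinD lee_fin -expr2 -real_normK ?num_real//.
    have := sqr_ge0 (e * `|f x| - 1); rewrite -(ler_pM2l e0) mulrDr divff ?gt_eqF//.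
    have := normr_ge0 (f x); nra.
rewrite ge0_integralD//; first last.
- exact: measurable_funeM.
- by move=> x _; rewrite -EFinM lee_fin; apply: mulr_ge0; [exact: ltW|rewrite -expr2 sqr_ge0].
- by move=> x _; rewrite lee_fin invr_ge0 ltW.
rewrite integral_cst; last exact: mI.
rewrite [X in (_ * X + _ <= _)%E]measure_I ge0_integralZl_EFin//; first last.
- exact: ltW.
- by move=> x _; rewrite lee_fin -expr2 sqr_ge0.
have e0E : (0 <= e%:E)%E by rewrite lee_fin ltW.
apply: le_trans (leeD (lexx _) (lee_wpmul2l e0E fC)) _.
rewrite -!EFinM -EFinD lee_fin natrX exprS -/e (_ : 4 = 2 ^+ 2 :> R); last by ring.
rewrite -exprM mulnC exprM -/e le_eqVlt; apply/orP; left; apply/eqP.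
by field; rewrite gt_eqF.
Qed.

(** The integrals of the successive differences are summable, so the telescoping
series converges absolutely at almost every point. *)
Lemma ae_limit (v : nat -> R -> R) (C : R) :
  (forall k, measurable_fun [set: R] (v k)) -> (forall k, zero_off_I (v k)) ->
  (forall k, (\int[mu]_(x in I) ((v k.+1 x - v k x) * (v k.+1 x - v k x))%:E
     <= (C / 4 ^+ k)%:E)%E) ->
  exists2 w : R -> R, measurable_fun [set: R] w &
    {ae mu, forall x, v k x @[k --> \oo] --> w x}.
Proof.
move=> mv ov vC.
exists (fun x => fine (limn_esup (fun k => (v k x)%:E))).
  apply: (@measurableT_comp _ _ _ _ _ _ fine) => //.
  apply: (@measurable_fun_limn_esup _ _ _ _ (fun k x => (v k x)%:E)) => k.
  exact/measurable_EFinP.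
suff : {ae mu, forall x, cvgn (fun k => v k x)}.
  apply: (@filterS _ _ ae_filter) => x /cvg_ex[l vl].
  suff /cvg_limn_einf_sup[_ ->] : (v k x)%:E @[k --> \oo] --> l%:E by [].
  by apply: cvg_EFin => //; exact: nearW.
pose d k x := v k.+1 x - v k x.
have C0 : 0 <= C.
  have := le_trans (integral_ge0 _ _) (vC 0%N); rewrite expr0 divr1 lee_fin; apply.
  by move=> x _; rewrite lee_fin -expr2 sqr_ge0.
have mI := @mI R.
have md k : measurable_fun I (d k).
  by apply: (@measurable_funS _ _ _ _ setT) => //; exact: measurable_funB.
have mdE k : measurable_fun I (fun x => (`|d k x|)%:E).
  by apply/measurable_EFinP; exact: measurableT_comp.
have sumd : (\int[mu]_(x in I) (\sum_(k <oo) (`|d k x|)%:E) < +oo)%E.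
  rewrite integral_nneseries//.
  apply: le_lt_trans (ltry (2 * (2 + C))).
  apply: le_trans (epsilon_trick0 xpredT _); last by rewrite mulr_ge0// addr_ge0.
  apply: lee_nneseries => [k *|k *]; last exact: (integral_abs_le (md k) (vC k)).
  by apply: integral_ge0 => x _; rewrite lee_fin.
have sumI : {ae mu, forall x, I x -> (\sum_(k <oo) (`|d k x|)%:E)%E \is a fin_num}.
  apply: integrable_ae => //; apply/integrableP; split.
    apply: (@ge0_emeasurable_sum _ _ _ I (fun k x => (`|d k x|)%:E) xpredT) => //.
  under eq_integral => x _.
    rewrite gee0_abs; last by apply: nneseries_ge0 => *; rewrite lee_fin.
    over.
  exact: sumd.
have ov' : {ae mu, forall x, forall k, ~ I x -> v k x = 0}.
  by apply: ae_foralln => k; exact: ov.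
apply: (@filterS2 _ _ ae_filter _ _ _ _ sumI ov') => x dx vx.
have [Ix|nIx] := pselect (I x); last first.
  rewrite (_ : (fun k => v k x) = cst 0); first exact: is_cvg_cst.
  by apply/funext => k; exact: vx.
have {dx}dfin := dx Ix.
have -> : (fun k => v k x) = (fun k => v 0%N x + series (d ^~ x) k).
  by apply/funext => k; exact: (eq_sum_telescope (fun k => v k x) k).
apply: is_cvgD; first exact: is_cvg_cst.
apply: normed_cvg; apply: nondecreasing_is_cvgn.
  by apply/nondecreasing_seqP => n; rewrite /normed_series_of /series/= big_nat_recr//= lerDl.
exists (fine (\sum_(k <oo) (`|d k x|)%:E)%E) => _ [n _ <-].
rewrite -lee_fin fineK// /normed_series_of /series/= -sumEFin.
by apply: nneseries_lim_ge => *; rewrite lee_fin.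
Qed.

(** The limit is taken pointwise almost everywhere, and Fatou's lemma bounds its
distance to each [v k] in both the L^2 norm and the energy. *)
Lemma H12_complete (v : nat -> R -> R) (C : R) : (forall k, H12 R (v k)) ->
  (forall k j, (k <= j)%N -> Gf (lin 1 (v j) (-1) (v k)) (lin 1 (v j) (-1) (v k)) <= C / 4 ^+ k /\
    dot (lin 1 (v j) (-1) (v k)) (lin 1 (v j) (-1) (v k)) <= C / 4 ^+ k) ->
  exists2 w, H12 R w & forall k,
    Gf (lin 1 w (-1) (v k)) (lin 1 w (-1) (v k)) <= C / 4 ^+ k /\
    dot (lin 1 w (-1) (v k)) (lin 1 w (-1) (v k)) <= C / 4 ^+ k.
Proof.
move=> Hv vC; pose D w u := lin 1 w (-1) u.
have mv k : measurable_fun [set: R] (v k) by have [] := (H12P _).1 (Hv k).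
have HD k j : H12 R (D (v j) (v k)) by exact: H12_lin.
have [w mw vw] : exists2 w : R -> R, measurable_fun [set: R] w &
    {ae mu, forall x, v k x @[k --> \oo] --> w x}.
  apply: (@ae_limit v C) => // [k|k]; first by have [] := (H12P _).1 (Hv k).
  have [_] := vC k k.+1 (leqnSn _); rewrite -lee_fin => /(le_trans _); apply.
  rewrite /dot /Rintegral fineK; last exact: (integrable_fin_num _ (dot_int (HD _ _) (HD _ _))).
  by under [leRHS]eq_integral do rewrite /lin !mul1r !mulN1r.
have mD k : measurable_fun [set: R] (D w (v k)) by exact: measurable_lin.
have L2D k : (L2sq (D w (v k)) <= (C / 4 ^+ k)%:E)%E.
  apply: (@fatou_bound _ _ mu (fun j x => D (v j) (v k) x ^+ 2)
    (fun x => D w (v k) x ^+ 2) _ k).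
  - by move=> j; apply: measurable_funX; exact: measurable_lin.
  - by apply: measurable_funX; exact: mD.
  - by move=> *; exact: sqr_ge0.
  - by move=> *; exact: sqr_ge0.
  - apply: (@filterS _ _ ae_filter _ _ _ vw) => x vx; rewrite expr2.
    under eq_fun do rewrite expr2.
    by apply: cvgM; apply: cvgD; apply: cvgM => //; exact: cvg_cst.
  - by move=> j kj; rewrite -/(L2sq _) -L2sq_dot// lee_fin; exact: (vC k j kj).2.
have ED k : (energy (D w (v k)) <= (C / 4 ^+ k)%:E)%E.
  apply: (@fatou_bound _ _ mu2 (fun j => gag (D (v j) (v k)) (D (v j) (v k)))
    (gag (D w (v k)) (D w (v k))) _ k).
  - by move=> j; apply: measurable_gag; exact: measurable_lin.
  - exact: measurable_gag.
  - by move=> *; exact: gag_ge0.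
  - by move=> *; exact: gag_ge0.
  - apply: (@filterS _ _ (@ae_filter_ringOfSetsType _ _ _ mu2) _ _ _ (ae_prod vw)) => z [z1 z2].
    rewrite gagE; under eq_fun do rewrite gagE.
    have cD : (D (v j) (v k) z.1 - D (v j) (v k) z.2) @[j --> \oo] -->
        (D w (v k) z.1 - D w (v k) z.2).
      by apply: cvgB; apply: cvgD; [apply: cvgM; [exact: cvg_cst|]|exact: cvg_cst
        |apply: cvgM; [exact: cvg_cst|]|exact: cvg_cst].
    by apply: cvgM; [exact: cvgM|exact: cvg_cst].
  - by move=> j kj; rewrite -/(energy _) -Gf_energy// lee_fin; exact: (vC k j kj).1.
have HDw k : H12 R (D w (v k)).
  apply/H12P; split => //.
  - by rewrite (le_lt_trans (L2D k))// ltry.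
  - by rewrite (le_lt_trans (ED k))// ltry.
  - have ov : {ae mu, forall x, forall k, ~ I x -> v k x = 0}.
      by apply: ae_foralln => j; have [] := (H12P _).1 (Hv j).
    apply: (@filterS2 _ _ ae_filter _ _ _ _ ov vw) => x vx wx nx.
    suff wx0 : w x = 0 by rewrite /D /lin wx0 vx// !mulr0 addr0.
    apply/esym; apply: (@cvg_unique _ _ _ _ _ _ _ wx) => //.
    rewrite (_ : (fun k => v k x) = cst 0); first exact: cvg_cst.
    by apply/funext => j; exact: vx.
exists w.
  rewrite (_ : w = lin 1 (D w (v 0%N)) 1 (v 0%N)); first exact: H12_lin.
  by apply/funext => x; rewrite /D /lin; ring.
move=> k; rewrite -!lee_fin; split.
  by rewrite Gf_energy; [exact: ED|exact: HDw].
by rewrite L2sq_dot; [exact: L2D|exact: HDw].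
Qed.

End Completeness.

(** * Averages over a partition *)

Section FiniteRank.
Context {R : realType}.
Implicit Types (u v w : R -> R).
Local Notation mu := (@lebesgue_measure R).
Local Notation mu2 := (leb R \x leb R)%E.
Local Notation I := (`]-1, 1[%classic : set R).

Lemma tonelli_rect (A B : set (measurableTypeR R)) (g : R * R -> R) : measurable A -> measurable B ->
  measurable_fun [set: R * R] g -> (forall z, 0 <= g z) ->
  (\int[mu2]_(z in A `*` B) (g z)%:E =
   \int[mu]_(x in A) \int[mu]_(y in B) (g (x, y))%:E)%E.
Proof.
move=> mA mB mg g0.
have mgE : measurable_fun [set: R * R] (EFin \o g) by exact/measurable_EFinP.
rewrite [LHS]integral_mkcond [LHS]fubini_tonelli1; first last.
- by move=> z; rewrite patchE; case: ifP => // _; rewrite lee_fin.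
- apply/(measurable_restrictT _ (measurableX mA mB)).
  exact: measurable_funTS.
rewrite [RHS]integral_mkcond; apply: eq_integral => x _.
rewrite patchE; case: ifPn => xA.
  rewrite [RHS]integral_mkcond; apply: eq_integral => y _.
  rewrite !patchE; congr (if _ then _ else _).
  by move: xA; rewrite inE => xA; apply/idP/idP; rewrite !inE; [case|split].
rewrite /fubini_F integral0_eq// => y _; rewrite patchE ifF//.
by apply/negbTE; apply: contra xA; rewrite !inE => -[].
Qed.

Lemma sq_int (J : set (measurableTypeR R)) u : measurable J -> (mu J < +oo)%E ->
  measurable_fun [set: R] u -> (L2sq u < +oo)%E ->
  [/\ mu.-integrable J (EFin \o u),
      mu.-integrable J (EFin \o (fun x => u x ^+ 2)) &
      forall a, mu.-integrable J (EFin \o cst a)].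
Proof.
move=> mJ Joo mu_ L2.
have i2 : mu.-integrable J (EFin \o (fun x => u x ^+ 2)).
  apply: (@integrableS _ _ _ _ setT) => //; apply/integrableP; split.
    by apply/measurable_EFinP; exact: measurable_funX.
  by under eq_integral do rewrite gee0_abs ?lee_fin ?sqr_ge0//.
have ic a : mu.-integrable J (EFin \o cst a).
  apply: measurable_bounded_integrable => //.
  exists `|a|; split; first exact: num_real.
  by move=> x ax y _ /=; exact: ltW.
split => //.
apply: (@le_integrable _ _ _ mu J mJ _ (EFin \o (fun x => 1 + u x ^+ 2))).
- by apply/measurable_EFinP; exact: measurable_funTS.
- move=> x _; rewrite -[leRHS]/(`|(1 + u x ^+ 2)%:E|)%E lee_fin.
  rewrite [leRHS]ger0_norm ?addr_ge0 ?sqr_ge0// -real_normK ?num_real//.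
  by have := normr_ge0 (u x); have := sqr_ge0 (`|u x| - 1); nra.
- exact: (integrableD mJ (ic 1) i2).
Qed.

(** Twice the variance: expand the square and integrate one variable at a time. *)
Lemma variance_rect (J : set (measurableTypeR R)) u : measurable J -> (mu J < +oo)%E ->
  measurable_fun [set: R] u -> (L2sq u < +oo)%E ->
  (\int[mu2]_(z in J `*` J) ((u z.1 - u z.2) ^+ 2)%:E =
   (2 * fine (mu J) * \int[mu]_(x in J) (u x ^+ 2) -
    2 * (\int[mu]_(x in J) u x) ^+ 2)%:E)%E.
Proof.
move=> mJ Joo mu_ L2; have [i1 i2 ic] := sq_int mJ Joo mu_ L2.
set h := fine _; set s := \int[mu]_(x in J) (u x ^+ 2); set m := \int[mu]_(x in J) u x.
rewrite (@tonelli_rect J J (fun z => (u z.1 - u z.2) ^+ 2))//; first last.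
- by move=> z; exact: sqr_ge0.
- by apply: measurable_funX; apply: measurable_funB; apply: measurableT_comp.
have E1 a b c : mu.-integrable J (EFin \o (fun y => a * (u y ^+ 2) + b * u y + c)) /\
    \int[mu]_(y in J) (a * (u y ^+ 2) + b * u y + c) = a * s + b * m + c * h.
  have ia := integrableZl mJ a i2; have ib := integrableZl mJ b i1.
  have iab := integrableD mJ ia ib.
  split; first exact: (integrableD mJ iab (ic c)).
  rewrite RintegralD//; last exact: ic.
  by rewrite Rintegral_lin// Rintegral_cst.
have E2 a b c : (\int[mu]_(y in J) (a * (u y ^+ 2) + b * u y + c)%:E =
    (a * s + b * m + c * h)%:E)%E.
  have [ii <-] := E1 a b c.
  by rewrite /Rintegral fineK//; exact: integrable_fin_num ii.
transitivity (\int[mu]_(x in J) (h * (u x ^+ 2) + (- 2 * m) * u x + s)%:E)%E.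
  apply: eq_integral => x _ /=.
  rewrite (_ : h * _ + _ + s = 1 * s + (- 2 * u x) * m + u x ^+ 2 * h); last by ring.
  rewrite -E2; apply: eq_integral => y _; congr EFin; ring.
rewrite E2; congr EFin; ring.
Qed.

Definition cell (a h : R) : set (measurableTypeR R) := `[a, (a + h)%R[%classic.

Lemma measurable_cell a h : measurable (cell a h).
Proof. exact: measurable_itv. Qed.

Lemma measure_cell a h : 0 <= h -> mu (cell a h) = h%:E.
Proof.
rewrite le_eqVlt => /predU1P[<-|h0].
  by rewrite /cell addr0 set_itvco0 measure0.
by rewrite lebesgue_measure_itv/= lte_fin ltrDl h0 -EFinD addrAC subrr add0r.
Qed.

(** Poincare's inequality on an interval of length [h]: both variables lie in the
cell, so [(x - y) ^+ 2 <= h ^+ 2]. *)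
Lemma cell_bound u (a h : R) : 0 < h -> measurable_fun [set: R] u -> (L2sq u < +oo)%E ->
  ((2 * h * \int[mu]_(x in cell a h) (u x ^+ 2) -
     2 * (\int[mu]_(x in cell a h) u x) ^+ 2)%:E <=
   (h ^+ 2)%:E * \int[mu2]_(z in cell a h `*` cell a h) (gag u u z)%:E)%E.
Proof.
move=> h0 mu_ L2; have mJ := measurable_cell a h.
have mJJ := measurableX mJ mJ.
have muJ := measure_cell a (ltW h0).
have := @variance_rect (cell a h) u mJ; rewrite muJ ltry => /(_ isT mu_ L2) <-.
have mg : measurable_fun [set: R * R] (gag u u) by exact: measurable_gag.
rewrite -ge0_integralZl_EFin//; last 3 first.
- by move=> z _; rewrite lee_fin gag_ge0.
- by apply/measurable_EFinP; exact: measurable_funTS.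
- exact: sqr_ge0.
apply: ge0_le_integral => //=.
- by move=> z _; rewrite lee_fin sqr_ge0.
- apply/measurable_EFinP; apply: measurable_funX; apply: measurable_funTS.
  by apply: measurable_funB; apply: measurableT_comp.
- by apply: measurable_funeM; apply/measurable_EFinP; exact: measurable_funTS.
- move=> [x y]; rewrite /cell /= !in_itv/= => -[/andP[ax xh] /andP[ay yh]].
  rewrite -EFinM lee_fin gagE/=.
  have [->|xy] := eqVneq x y; first by rewrite !subrr expr0n mulr0 mul0r mulr0.
  have xy0 : 0 < (x - y) ^+ 2 by rewrite exprn_even_gt0//= subr_eq0.
  rewrite mulrA ler_pdivlMr// -expr2 mulrC ler_wpM2r ?sqr_ge0//; nra.
Qed.

(** Adding the cell inequalities keeps only the diagonal blocks of the double
integral, which are disjoint. *)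
Lemma cells_bound u (h : R) n : 0 < h -> measurable_fun [set: R] u -> (L2sq u < +oo)%E ->
  ((2 * h * \int[mu]_(x in cell (-1) (n%:R * h)) (u x ^+ 2) -
     2 * \sum_(i < n) (\int[mu]_(x in cell (-1 + i%:R * h) h) u x) ^+ 2)%:E <=
   (h ^+ 2)%:E * \int[mu2]_(z in cell (-1) (n%:R * h) `*` cell (-1) (n%:R * h))
     (gag u u z)%:E)%E.
Proof.
move=> h0 mu_ L2.
have mg : measurable_fun [set: R * R] (gag u u) by exact: measurable_gag.
have h2 : (0 <= (h ^+ 2)%:E)%E by rewrite lee_fin sqr_ge0.
elim: n => [|n IH].
  rewrite mul0r big_ord0 mulr0 subr0 /cell addr0 set_itvco0 Rintegral_set0 mulr0.
  by rewrite mule_ge0//; apply: integral_ge0 => z _; rewrite lee_fin gag_ge0.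
set A := cell (-1) (n%:R * h) in IH *; set J := cell (-1 + n%:R * h) h.
have AJ : cell (-1) (n.+1%:R * h) = A `|` J.
  rewrite /A /J /cell -addrA -natr1 mulrDl mul1r.
  have nh : 0 <= n%:R * h by rewrite mulr_ge0// ltW.
  by apply: itv_bndbnd_setU; rewrite bnd_simp; lra.
have mA : measurable A by exact: measurable_cell.
have mJ : measurable J by exact: measurable_cell.
have dAJ x : A x -> J x -> False.
  by rewrite /A /J /cell /= !in_itv/= => /andP[_ xa] /andP[ax _]; lra.
have mAA := measurableX mA mA; have mJJ := measurableX mJ mJ.
have mUU := measurableX (measurableU _ _ mA mJ) (measurableU _ _ mA mJ).
have gU : (\int[mu2]_(z in A `*` A) (gag u u z)%:E +
    \int[mu2]_(z in J `*` J) (gag u u z)%:E <=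
    \int[mu2]_(z in (A `|` J) `*` (A `|` J)) (gag u u z)%:E)%E.
  rewrite -ge0_integral_setU//.
  - apply: ge0_subset_integral => //.
    + exact: measurableU.
    + by apply/measurable_EFinP; exact: measurable_funTS.
    + by move=> z _; rewrite lee_fin gag_ge0.
    + by move=> z [[z1 z2]|[z1 z2]]; split; [left|left|right|right].
  - by apply/measurable_EFinP; exact: measurable_funTS.
  - by move=> z _; rewrite lee_fin gag_ge0.
  - by apply/disj_setPS => z [[z1 _] [z2 _]]; exact: (dAJ z.1).
have oo : (mu (A `|` J) < +oo)%E.
  by rewrite -AJ measure_cell ?ltry// mulr_ge0// ltW.
have mAJ := measurableU _ _ mA mJ.
have [i1 i2 _] := sq_int mAJ oo mu_ L2.
rewrite AJ big_ord_recr/= -/J Rintegral_setU//; last first.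
  by apply/disj_setPS => x [xA xJ]; exact: (dAJ x).
apply: le_trans (lee_wpmul2l h2 gU); rewrite ge0_muleDr; last 2 first.
- by apply: integral_ge0 => z _; rewrite lee_fin gag_ge0.
- by apply: integral_ge0 => z _; rewrite lee_fin gag_ge0.
apply: le_trans (leeD IH (cell_bound (-1 + n%:R * h) h0 mu_ L2)).
rewrite -EFinD lee_fin -/J; lra.
Qed.

(** A quantitative form of Rellich's theorem: cut the interval into [n >= A] cells
of length [h = 2 / n], and let [l i] be the integral over the [i]-th cell.  Up
to the averages, the squared L^2 norm is then at most [h / 2] times the energy, that is
[1 / n] times. *)
Lemma finite_rank (A : R) : exists n (l : 'I_n -> (R -> R) -> R) (C : R),
  [/\ 0 <= C,
      forall i a u b v, H12 R u -> H12 R v -> l i (lin a u b v) = a * l i u + b * l i v,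
      forall i u, H12 R u -> l i u ^+ 2 <= 2 * dot u u &
      forall u, H12 R u -> A * dot u u <= Gf u u + C * \sum_(i < n) l i u ^+ 2].
Proof.
have [n An n1] : exists2 n, A <= n%:R & (0 < n)%N.
  exists (Num.truncn `|A|).+1 => //.
  by rewrite (le_trans (ler_norm A))// ltW// truncnS_gt.
have n0 : 0 < n%:R :> R by rewrite ltr0n.
have [h h0 hn] : exists2 h : R, 0 < h & n%:R * h = 2.
  by exists (2 / n%:R); [rewrite divr_gt0|rewrite mulrCA divff ?mulr1// gt_eqF].
pose J (i : 'I_n) := cell (-1 + i%:R * h) h.
have mJ i : measurable (J i) by exact: measurable_cell.
have muJ i : mu (J i) = h%:E by exact: measure_cell (ltW h0).
have Joo i : (mu (J i) < +oo)%E by rewrite muJ ltry.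
have dotE u : H12 R u -> dot u u = \int[mu]_(x in cell (-1) 2) (u x ^+ 2).
  move=> Hu; rewrite /dot /cell (_ : -1 + 2 = 1 :> R); last by ring.
  rewrite -(@Rintegral_itv_obnd_cbnd _ (-1) (BLeft 1)).
    by apply: eq_Rintegral => x _; rewrite expr2.
  have := dot_int Hu Hu; apply: eq_integrable => [|x _]; first exact: mI.
  by rewrite /= expr2.
exists n, (fun i u => \int[mu]_(x in J i) u x), (n%:R / h); split.
- by rewrite divr_ge0// ltW.
- move=> i a u b v /H12P[mu_ Lu _ _] /H12P[mv Lv _ _].
  have [iu _ _] := sq_int (mJ i) (Joo i) mu_ Lu.
  have [iv _ _] := sq_int (mJ i) (Joo i) mv Lv.
  exact: Rintegral_lin.
- move=> i u Hu; have [mu_ Lu _ _] := (H12P u).1 Hu.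
  have [_ i2 _] := sq_int (mJ i) (Joo i) mu_ Lu.
  have sdot : \int[mu]_(x in J i) (u x ^+ 2) <= dot u u.
    rewrite -lee_fin L2sq_dot// /Rintegral fineK; last exact: integrable_fin_num i2.
    apply: ge0_subset_integral => //.
    + by apply/measurable_EFinP; exact: measurable_funX.
    + by move=> x _; rewrite lee_fin sqr_ge0.
  have : (0 <= \int[mu2]_(z in J i `*` J i) ((u z.1 - u z.2) ^+ 2)%:E)%E.
    by apply: integral_ge0 => z _; rewrite lee_fin sqr_ge0.
  rewrite (variance_rect (mJ i) (Joo i) mu_ Lu) muJ lee_fin /=.
  have h2 : h <= 2 by rewrite -hn ler_peMl ?ler1n// ltW.
  have s0 : 0 <= \int[mu]_(x in J i) (u x ^+ 2).
    by apply: Rintegral_ge0 => x _; exact: sqr_ge0.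
  move: (\int[mu]_(x in J i) (u x ^+ 2)) (ler_pM (ltW h0) s0 h2 sdot) => s hs.
  by move: (\int[mu]_(x in J i) u x) => m; lra.
- move=> u Hu; have [mu_ Lu _ _] := (H12P u).1 Hu.
  have := cells_bound n h0 mu_ Lu; rewrite hn -dotE//.
  have mg : measurable_fun [set: R * R] (gag u u) by exact: measurable_gag.
  have mC := measurableX (measurable_cell (-1) 2) (measurable_cell (-1) 2).
  have h2 : (0 <= (h ^+ 2)%:E)%E by rewrite lee_fin sqr_ge0.
  have le : (\int[mu2]_(z in cell (-1) 2 `*` cell (-1) 2) (gag u u z)%:E <= energy u)%E.
    apply: ge0_subset_integral => //.
    + by apply/measurable_EFinP.
    + by move=> z _; rewrite lee_fin gag_ge0.
  move=> /le_trans/(_ (lee_wpmul2l h2 le)).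
  rewrite -Gf_energy// -EFinM lee_fin.
  set S := \sum_(i < n) _; move=> H.
  apply: (@le_trans _ _ (n%:R * dot u u)); first by rewrite ler_wpM2r// dot_ge0.
  have h2' : 0 < h ^+ 2 by rewrite exprn_gt0.
  rewrite -(ler_pM2l h2') (_ : h ^+ 2 * (n%:R * dot u u) = 2 * h * dot u u); last first.
    by rewrite expr2 -hn; ring.
  rewrite mulrDr (_ : h ^+ 2 * (n%:R / h * S) = 2 * S); last first.
    by rewrite -hn; field; rewrite gt_eqF.
  by rewrite -/S in H *; lra.
Qed.

End FiniteRank.

(** * Symmetric bilinear forms and minimisers *)

Section Variational.
Context {R : realType}.
Implicit Types (u v w f V : R -> R) (F G : (R -> R) -> (R -> R) -> R).
Local Notation mu := (@lebesgue_measure R).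
Local Notation I := (`]-1, 1[%classic : set R).

(** Compactness of a cube, for finitely many averages at once. *)
Lemma cluster_seq N (x : nat -> 'I_N -> R) (K : R) :
  (forall n i, `|x n i| <= K) ->
  exists p : 'I_N -> R, forall k (e : R), 0 < e ->
    exists2 n, (k <= n)%N & forall i, `|p i - x n i| < e.
Proof.
move=> xK.
have cK := @rV_compact R N (fun=> `[(- K), K]%classic) (fun=> @segment_compact R (- K) K).
pose X n : 'rV[R]_N := \row_i x n i.
have := cK (fmap X \oo) _.
move=> /(_ _)[|p [_ clp]].
  by exists 0%N => // n _ i /=; rewrite mxE in_itv/= -ler_norml.
exists (fun i => p ord0 i) => k e e0.
have := clp (X @` [set n | (k <= n)%N]) (ball p e) _ _.
move=> [||_ [[n kn <-] pn]].
- by exists k => // n kn; exists n.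
- exact: nbhsx_ballx.
exists n => // i; have [_ /(_ ord0 i)] := pn.
by rewrite /X mxE -ball_normE.
Qed.

Lemma le_geom0 (t C : R) : (forall k, t <= C / 4 ^+ k) -> t <= 0.
Proof.
move=> tC; rewrite leNgt; apply/negP => t0.
have C0 : 0 < C by have := tC 0%N; rewrite expr0 divr1; exact: lt_le_trans.
pose k := (Num.truncn (C / t)).+1.
have kC : C / t < k%:R by exact: truncnS_gt.
have k4 : k%:R <= 4 ^+ k :> R by rewrite -natrX ler_nat ltnW// ltn_expl.
have := tC k; rewrite ler_pdivlMr ?exprn_gt0//.
move: kC; rewrite ltr_pdivrMr// => kC; have := ler_wpM2r (ltW t0) k4; lra.
Qed.

(** Linearity is only asked on [H12], where the integrals exist. *)
Definition bilin F := (forall u v, F u v = F v u) /\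
  forall a u b v w, H12 R u -> H12 R v -> H12 R w ->
    F (lin a u b v) w = a * F u w + b * F v w.

Lemma bilin_r F a u b v w : bilin F -> H12 R u -> H12 R v -> H12 R w ->
  F w (lin a u b v) = a * F w u + b * F w v.
Proof. by move=> [s l] Hu Hv Hw; rewrite s l// !(s w). Qed.

Lemma bilin_quad F a u b v : bilin F -> H12 R u -> H12 R v ->
  F (lin a u b v) (lin a u b v) =
  a ^+ 2 * F u u + 2 * a * b * F u v + b ^+ 2 * F v v.
Proof.
move=> bF Hu Hv; have Hl := H12_lin a b Hu Hv; have [s l] := bF.
by rewrite l// !(bilin_r _ _ bF)// (s v u); ring.
Qed.

Lemma bilin_comb F G a b : bilin F -> bilin G ->
  bilin (fun u v => a * F u v + b * G u v).
Proof.
move=> [sF lF] [sG lG]; split=> [u v|c u d v w Hu Hv Hw]; first by rewrite sF sG.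
by rewrite lF// lG//; ring.
Qed.

Lemma bilin_dot : bilin (@dot R).
Proof. by split; [exact: dot_sym|move=> *; exact: dot_lin]. Qed.

Lemma bilin_Gf : bilin (@Gf R).
Proof. by split; [exact: Gf_sym|move=> *; exact: Gf_lin]. Qed.

Lemma bilin_pot V : bounded_potential V -> bilin (pot V).
Proof. by move=> bV; split; [exact: pot_sym|move=> *; exact: pot_lin]. Qed.

(** The left-hand side of the weak eigenvalue equation. *)
Definition form V u v : R := E_res (2^-1 : R) u v + pot V u v.

Lemma formE V u v : form V u v = c_frac (2^-1 : R) / 2 * Gf u v + 1 * pot V u v.
Proof. by rewrite mul1r. Qed.

Lemma bilin_form V : bounded_potential V -> bilin (form V).
Proof.
move=> bV; rewrite (_ : form V = fun u v => c_frac (2^-1 : R) / 2 * Gf u v + 1 * pot V u v).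
  by apply: bilin_comb; [exact: bilin_Gf|exact: bilin_pot].
by apply/funext => u; apply/funext => v; exact: formE.
Qed.

(** Cauchy-Schwarz for a positive semidefinite form: a null vector is in the
kernel.  The quadratic form at [(q + 1) u - p w], with [p = F u w] and
[q = F w w], equals [(q + 1)^2 F u u - (q + 2) p^2], which forces [p = 0].  The
subspace [K] allows for an orthogonality constraint. *)
Lemma psd_null F (K : (R -> R) -> Prop) u w : bilin F ->
  (forall w, K w -> H12 R w) -> (forall a u b v, K u -> K v -> K (lin a u b v)) ->
  (forall w, K w -> 0 <= F w w) -> K u -> F u u <= 0 -> K w -> F u w = 0.
Proof.
move=> bF KH Klin F0 Ku Fu Kw; set p := F u w; pose q := F w w.
have q0 : 0 <= q by exact: F0.
have := F0 _ (Klin (q + 1) u (- p) w Ku Kw).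
rewrite bilin_quad//; [|exact: KH..].
rewrite -/p -/q => h; apply/eqP; rewrite -sqrf_eq0; apply/eqP/le_anti.
rewrite sqr_ge0 andbT.
have : (q + 1) ^+ 2 * F u u <= 0 by rewrite mulr_ge0_le0// sqr_ge0.
have := sqr_ge0 p; nra.
Qed.

Lemma dot_CS u v : H12 R u -> H12 R v -> dot u v ^+ 2 <= dot u u * dot v v.
Proof.
move=> Hu Hv; have u0 := dot_ge0 u; have v0 := dot_ge0 v.
have [dv0|dv] := eqVneq (dot v v) 0.
  suff -> : dot u v = 0 by rewrite expr0n dv0 mulr0.
  rewrite dot_sym; apply: (@psd_null _ (H12 R) v u bilin_dot) => //.
  - by move=> *; exact: H12_lin.
  - by move=> *; exact: dot_ge0.
  - by rewrite dv0.
have dvp : 0 < dot v v by rewrite lt_neqAle eq_sym dv.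
have := dot_ge0 (lin (dot v v) u (- dot u v) v).
rewrite (bilin_quad _ _ bilin_dot)// => h.
rewrite -(ler_pM2l dvp); nra.
Qed.

Lemma pot_le V (M : R) u : bounded_potential V -> (forall x, I x -> `|V x| <= M) -> H12 R u ->
  `|pot V u u| <= M * dot u u.
Proof.
move=> bV VM Hu; have iV := pot_int bV Hu Hu; have id := dot_int Hu Hu.
have iM := integrableZl (@mI R) M id.
apply: le_trans (le_normr_Rintegral (@mI R) iV) _.
rewrite -RintegralZl//.
apply: le_Rintegral => //; first exact: integrable_norm iV.
move=> x Ix; have uu0 : 0 <= u x * u x by rewrite -expr2 sqr_ge0.
by rewrite -mulrA normrM (ger0_norm uu0) ler_wpM2r// VM.
Qed.

(** The direct method, without weak convergence.  With [m] a lower bound of the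
Rayleigh quotient on the complement of [f], the form [D = form V - m * dot] is
positive semidefinite there, and along a normalised minimising sequence [D] is
of order [4 ^- k].  By the parallelogram law [D] is small on differences.  A
subsequence along which the finitely many functionals of [finite_rank] converge
at rate [2 ^- k] is then Cauchy in L^2, hence in energy. *)
Lemma minimiser V f (m : R) : bounded_potential V -> H12 R f ->
  (forall w, H12 R w -> dot w f = 0 -> m * dot w w <= form V w w) ->
  (forall e : R, 0 < e -> exists w,
     [/\ H12 R w, dot w f = 0, dot w w = 1 & form V w w <= m + e]) ->
  exists u, [/\ H12 R u, dot u f = 0, 0 < dot u u & form V u u <= m * dot u u].
Proof.
move=> bV Hf mlb mseq.
have [_ [M VM]] := bV.
have c0 : 0 < c_frac (2^-1 : R) / 2 by rewrite divr_gt0// c_frac_gt0.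
pose D u v := 1 * form V u v + (- m) * dot u v.
have bD : bilin D by apply: bilin_comb; [exact: bilin_form|exact: bilin_dot].
have D0 w : H12 R w -> dot w f = 0 -> 0 <= D w w.
  by move=> Hw wf; have := mlb _ Hw wf; rewrite /D; lra.
pose L := `|M| + `|m|.
have DL w : H12 R w -> `|D w w - c_frac (2^-1 : R) / 2 * Gf w w| <= L * dot w w.
  move=> Hw; rewrite /D formE !mul1r addrAC [X in X + _]addrAC subrr add0r mulNr.
  apply: le_trans (ler_normB _ _) _; rewrite /L mulrDl normrM (ger0_norm (dot_ge0 w)).
  rewrite lerD2r (le_trans (pot_le bV VM Hw))// ler_wpM2r ?dot_ge0//.
  exact: ler_norm.
have L0 : 0 <= L by rewrite addr_ge0.
have [N [l [C [C0 llin lle lfin]]]] :=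
  finite_rank ((c_frac (2^-1 : R) / 2)^-1 * (L + 1)).
pose C' := c_frac (2^-1 : R) / 2 * C.
have C'0 : 0 <= C' by rewrite mulr_ge0// ltW.
(* The rank was chosen so that the bounded part L * dot is absorbed, with
   dot itself to spare. *)
have coer w : H12 R w -> dot w w <= D w w + C' * \sum_(i < N) l i w ^+ 2.
  move=> Hw; have := lfin w Hw; rewrite -(ler_pM2l c0) mulrA mulrA.
  rewrite divff ?gt_eqF// mul1r mulrDr mulrA -/C' => h.
  by have := DL w Hw; rewrite ler_distl => /andP[h1 h2]; lra.
have Gle w : H12 R w ->
    Gf w w <= (c_frac (2^-1 : R) / 2)^-1 * (D w w + L * dot w w).
  move=> Hw; rewrite ler_pdivlMl//.
  by have := DL w Hw; rewrite ler_distl => /andP[h1 h2]; lra.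
have /choice[w wP] : forall n : nat, exists w, [/\ H12 R w, dot w f = 0,
    dot w w = 1 & D w w <= (4 ^+ n)^-1].
  move=> n; have [|w [Hw wf w1 we]] := mseq (4 ^+ n)^-1.
    by rewrite invr_gt0 exprn_gt0.
  by exists w; split => //; rewrite /D w1; lra.
have lb n i : `|l i (w n)| <= 2.
  have [Hw _ w1 _] := wP n; rewrite -(@ler_pXn2r _ 2)// ?nnegrE// real_normK ?num_real//.
  by rewrite (le_trans (lle i _ Hw))// w1; lra.
have [p pP] := cluster_seq lb.
have /choice[s sP] : forall k : nat, exists n : nat,
    (k <= n)%N /\ forall i, `|p i - l i (w n)| < (2 ^+ k)^-1.
  move=> k; have [|n kn np] := pP k (2 ^+ k)^-1; last by exists n.
  by rewrite invr_gt0 exprn_gt0.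
(* The functionals of v k are within 2^-k of their limits, and s k >= k keeps
   D (v k) below 4^-k. *)
pose v k := w (s k).
have Hv k : H12 R (v k) by have [] := wP (s k).
have vf k : dot (v k) f = 0 by have [] := wP (s k).
have v1 k : dot (v k) (v k) = 1 by have [] := wP (s k).
have vD k : D (v k) (v k) <= (4 ^+ k)^-1.
  have [_ _ _ h] := wP (s k); rewrite (le_trans h)// lef_pV2 ?posrE ?exprn_gt0//.
  by rewrite ler_weXn2l ?ler1n//; have [] := sP k.
pose d j k := lin 1 (v j) (-1) (v k).
have Hd j k : H12 R (d j k) by exact: H12_lin.
have pow4 k j : (k <= j)%N -> (4 ^+ j)^-1 <= (4 ^+ k)^-1 :> R.
  by move=> kj; rewrite lef_pV2 ?posrE ?exprn_gt0// ler_weXn2l ?ler1n.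
have dlf j k : dot (d j k) f = 0 by rewrite dot_lin// !vf !mulr0 addr0.
(* Parallelogram law: D (v j - v k) <= 2 D (v j) + 2 D (v k). *)
have Dd j k : (k <= j)%N -> D (d j k) (d j k) <= 4 * (4 ^+ k)^-1.
  move=> kj; have := D0 (lin 1 (v j) 1 (v k)) (H12_lin _ _ (Hv j) (Hv k)).
  rewrite dot_lin// !vf !mulr0 addr0 => /(_ erefl).
  rewrite /d !(bilin_quad _ _ bD)// => h.
  by have := vD j; have := vD k; have := pow4 _ _ kj; lra.
have ld j k i : (k <= j)%N -> l i (d j k) ^+ 2 <= 4 * (4 ^+ k)^-1.
  move=> kj; rewrite llin// !mul1r mulN1r.
  have e2 : 0 < (2 ^+ k)^-1 :> R by rewrite invr_gt0 exprn_gt0.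
  rewrite (_ : 4 ^+ k = (2 ^+ k) ^+ 2 :> R); last first.
    by rewrite -exprM mulnC exprM; congr (_ ^+ k); ring.
  have h1 := (sP k).2 i.
  have h2 : `|p i - l i (v j)| < (2 ^+ k)^-1.
    apply: lt_le_trans ((sP j).2 i) _.
    by rewrite lef_pV2 ?posrE ?exprn_gt0// ler_weXn2l ?ler1n.
  rewrite -exprVn; move: (2 ^+ k)^-1 e2 h1 h2 => e e0.
  rewrite -/(v k) !ltr_norml => /andP[a1 a2] /andP[b1 b2]; nra.
pose K1 := 4 + C' * (N%:R * 4).
have K10 : 0 <= K1 by rewrite addr_ge0// mulr_ge0// mulr_ge0.
(* Both D and the functionals are small on d j k, hence so is its L^2 norm,
   and then its energy. *)
have dd j k : (k <= j)%N -> dot (d j k) (d j k) <= K1 * (4 ^+ k)^-1.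
  move=> kj; apply: le_trans (coer _ (Hd j k)) _.
  rewrite /K1 mulrDl lerD ?Dd// -mulrA ler_wpM2l//.
  apply: le_trans (ler_sum _ (fun i _ => ld j k i kj)) _.
  by rewrite sumr_const card_ord -[_ *+ N]mulr_natl mulrA.
pose c2 := (c_frac (2^-1 : R) / 2)^-1.
have c20 : 0 < c2 by rewrite invr_gt0.
pose K2 := c2 * (4 + L * K1).
have K20 : 0 <= K2 by rewrite mulr_ge0 ?(ltW c20)// addr_ge0// mulr_ge0.
have Gd j k : (k <= j)%N -> Gf (d j k) (d j k) <= K2 * (4 ^+ k)^-1.
  move=> kj; apply: le_trans (Gle _ (Hd j k)) _.
  rewrite /K2 -/c2 -mulrA ler_wpM2l ?(ltW c20)// [leRHS]mulrDl lerD ?Dd// -mulrA.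
  by rewrite ler_wpM2l// dd.
have ei k : 0 < (4 ^+ k)^-1 :> R by rewrite invr_gt0 exprn_gt0.
have [u Hu uv] : exists2 u, H12 R u & forall k,
    Gf (lin 1 u (-1) (v k)) (lin 1 u (-1) (v k)) <= (K1 + K2) / 4 ^+ k /\
    dot (lin 1 u (-1) (v k)) (lin 1 u (-1) (v k)) <= (K1 + K2) / 4 ^+ k.
  apply: H12_complete => // k j kj; have := dd j k kj; have := Gd j k kj.
  rewrite -/(d j k) [(K1 + K2) * _]mulrDl.
  have := mulr_ge0 K10 (ltW (ei k)); have := mulr_ge0 K20 (ltW (ei k)).
  by split; lra.
exists u; pose K := K1 + K2.
have K0 : 0 <= K by rewrite addr_ge0.
pose r k := lin 1 u (-1) (v k).
have Hr k : H12 R (r k) by exact: H12_lin.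
have Er k : u = lin 1 (r k) 1 (v k) by apply/funext => x; rewrite /r /lin; ring.
have uf : dot u f = 0.
  apply/eqP; rewrite -sqrf_eq0 eq_le sqr_ge0 andbT.
  apply: (@le_geom0 _ (K * dot f f)) => k.
  rewrite {1}(Er k) dot_lin// vf mulr0 addr0 mul1r (le_trans (dot_CS (Hr k) Hf))//.
  by rewrite mulrAC ler_wpM2r ?dot_ge0//; have [] := uv k.
(* Parallelogram law again, for u = r k + v k with r k small. *)
have Du : D u u <= 0.
  apply: (@le_geom0 _ (2 + 2 * (c_frac (2^-1 : R) / 2 + L) * K)) => k.
  have Drp : D (r k) (r k) <= (c_frac (2^-1 : R) / 2 + L) * (K / 4 ^+ k).
    have [g1 g2] := uv k; have := DL _ (Hr k); rewrite ler_distl => /andP[_ h].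
    have := ler_wpM2l (ltW c0) g1; have := ler_wpM2l L0 g2; rewrite -/(r k) -/K.
    lra.
  have : 0 <= D (lin 1 (r k) (-1) (v k)) (lin 1 (r k) (-1) (v k)).
    apply: D0; first exact: H12_lin.
    by rewrite dot_lin// vf mulr0 addr0 /r dot_lin// uf vf !mulr0 addr0 mulr0.
  have -> : D u u = D (lin 1 (r k) 1 (v k)) (lin 1 (r k) 1 (v k)) by rewrite -Er.
  rewrite !(bilin_quad _ _ bD (Hr k) (Hv k)).
  by have := vD k; rewrite mulrDl; lra.
split => //; last by move: Du; rewrite /D; lra.
(* Were u = 0, the unit vectors v k would tend to 0. *)
rewrite ltNge; apply/negP => du0.
suff : (1 : R) <= 0 by rewrite leNgt ltr01.
apply: (@le_geom0 _ (2 * K)) => k.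
apply: (@le_trans _ _ (dot (v k) (v k))); first by rewrite v1.
have -> : v k = lin 1 u (-1) (r k) by apply/funext => x; rewrite /r /lin; ring.
rewrite (bilin_quad _ _ bilin_dot)//.
have [_] := uv k; rewrite -/(r k) -/K => h.
have : 0 <= dot (lin 1 u 1 (r k)) (lin 1 u 1 (r k)) by exact: dot_ge0.
by rewrite (bilin_quad _ _ bilin_dot)//; lra.
Qed.

End Variational.

(** * Orthogonal minimisers are eigenfunctions *)

Section Spectrum.
Context {R : realType}.
Implicit Types (u v w f V : R -> R).
Local Notation mu := (@lebesgue_measure R).
Local Notation I := (`]-1, 1[%classic : set R).

Lemma ae_zeroP u : H12 R u -> ae_zero u <-> dot u u = 0.
Proof.
move=> Hu; have [mu_ _ _ _] := (H12P u).1 Hu.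
have mu2 : measurable_fun [set: R] (fun x => (u x ^+ 2)%:E).
  by apply/measurable_EFinP; exact: measurable_funX.
have E : L2sq u = (\int[mu]_x `|(u x ^+ 2)%:E|)%E.
  by apply: eq_integral => x _; rewrite gee0_abs// lee_fin sqr_ge0.
have -> : dot u u = 0 <-> L2sq u = 0%E.
  by rewrite -L2sq_dot//; split=> [->//|[]].
rewrite E; split=> [h|/(ae_eq_integral_abs mu measurableT mu2) h].
  apply/(ae_eq_integral_abs mu measurableT mu2).
  by apply: (@filterS _ _ ae_filter _ _ _ h) => x -> _; rewrite expr0n.
by apply: (@filterS _ _ ae_filter _ _ _ h) => x /(_ Logic.I)[/eqP]; rewrite sqrf_eq0 => /eqP.
Qed.

Lemma H12_zero : H12 R (fun=> 0).
Proof.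
apply/H12P; split.
- exact: measurable_cst.
- rewrite /L2sq integral0_eq ?ltry// => x _; by rewrite expr0n.
- rewrite /energy integral0_eq ?ltry// => z _; by rewrite gagE subrr !mul0r.
- by apply: (@filterE _ _ ae_filter).
Qed.

Lemma dot_zero_l u w : H12 R u -> H12 R w -> dot u u = 0 -> dot u w = 0.
Proof.
move=> Hu Hw u0; have := dot_CS Hu Hw; rewrite u0 mul0r => h.
by apply/eqP; rewrite -sqrf_eq0 eq_le h sqr_ge0.
Qed.

Lemma form_ge V : bounded_potential V -> exists M : R,
  forall w, H12 R w -> M * dot w w <= form V w w.
Proof.
move=> bV; have [_ [M VM]] := bV; exists (- M) => w Hw.
have := pot_le bV VM Hw; rewrite ler_norml formE => /andP[h _].
have : 0 <= c_frac (2^-1 : R) / 2 * Gf w w.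
  by rewrite mulr_ge0 ?Gf_ge0// divr_ge0// ltW// c_frac_gt0.
lra.
Qed.

(** Minimising over the complement of [f] gives the weak equation against test
functions orthogonal to [f] only; the direction [f] is covered because [f]
itself solves a weak equation.  The case [f = 0] is the unconstrained minimum. *)
Lemma spectral_minimum V f (nu : R) : bounded_potential V -> H12 R f ->
  (forall w, H12 R w -> form V f w = nu * dot f w) ->
  (exists w, [/\ H12 R w, dot w f = 0 & 0 < dot w w]) ->
  exists m u, [/\ frac_eigenspace 2^-1 `]-1, 1[ V m u, dot u f = 0, 0 < dot u u &
    forall w, H12 R w -> dot w f = 0 -> m * dot w w <= form V w w].
Proof.
move=> bV Hf fe [w0 [Hw0 w0f w00]].
have bF := bilin_form bV; have [M FM] := form_ge bV.
pose S := [set r : R | exists w, [/\ H12 R w, dot w f = 0, 0 < dot w w &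
  r = form V w w / dot w w]].
have infS : has_inf S.
  split; first by exists (form V w0 w0 / dot w0 w0), w0.
  by exists M => _ [w [Hw _ w_ ->]]; rewrite ler_pdivlMr// FM.
pose m := inf S.
have mlb w : H12 R w -> dot w f = 0 -> m * dot w w <= form V w w.
  move=> Hw wf; have := dot_ge0 w; rewrite le_eqVlt => /predU1P[w_0|w_].
    by have := FM _ Hw; rewrite -w_0 !mulr0.
  by rewrite -ler_pdivlMr//; apply: ge_inf; [exact: infS.2|exists w].
have [u [Hu uf u0 um]] : exists u, [/\ H12 R u, dot u f = 0, 0 < dot u u &
    form V u u <= m * dot u u].
  apply: minimiser => // e e0; have [_ [w [Hw wf w_ ->]] we] := inf_adherent e0 infS.
  pose a := (Num.sqrt (dot w w))^-1.
  have a2 : a ^+ 2 * dot w w = 1.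
    by rewrite exprVn sqr_sqrtr ?dot_ge0// mulVf// gt_eqF.
  exists (lin a w 0 w); split; first exact: H12_lin.
  - by rewrite dot_lin// wf !mulr0 addr0.
  - by rewrite (bilin_quad _ _ bilin_dot)// a2; ring.
  - rewrite (bilin_quad _ _ bF)// mulr0 !mul0r expr0n mul0r !addr0.
    move: we; rewrite -/m ltr_pdivrMr// => we.
    have a0 : 0 <= a ^+ 2 by exact: sqr_ge0.
    by rewrite (le_trans (ler_wpM2l a0 (ltW we)))// mulrCA a2 mulr1.
exists m, u; split => //; split => // w Hw.
suff : form V u w = m * dot u w by [].
pose D u v := 1 * form V u v + (- m) * dot u v.
have bD : bilin D by apply: bilin_comb; [exact: bilin_form|exact: bilin_dot].
suff : D u w = 0 by rewrite /D; lra.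
(* The minimiser is a null vector of the form D, which is nonnegative on the
   complement of f. *)
have DK v : H12 R v -> dot v f = 0 -> D u v = 0.
  move=> Hv vf; apply: (@psd_null _ D (fun w => H12 R w /\ dot w f = 0) u v bD) => //.
  - by move=> ? [].
  - move=> a v1 b v2 [H1 f1] [H2 f2]; split; first exact: H12_lin.
    by rewrite dot_lin// f1 f2 !mulr0 addr0.
  - by move=> v' [H' f']; have := mlb _ H' f'; rewrite /D; lra.
  - by rewrite /D; lra.
have Duf : D u f = 0.
  rewrite /D (proj1 bF) fe// (dot_sym f u) uf; ring.
have [f0|f0] := eqVneq (dot f f) 0.
  by apply: DK => //; rewrite dot_sym; exact: dot_zero_l.
pose w' := lin 1 w (- (dot w f / dot f f)) f.
have -> : w = lin 1 w' (dot w f / dot f f) f.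
  by apply/funext => x; rewrite /w' /lin; ring.
have Hw' : H12 R w' by exact: H12_lin.
rewrite (bilin_r _ _ bD)// Duf DK// ?mulr0 ?addr0//.
by rewrite dot_lin// mul1r mulNr divfK// subrr.
Qed.

End Spectrum.

(** * Reflection and a Hardy inequality for odd functions *)

Section Parity.
Context {R : realType}.
Implicit Types (u v w f V : R -> R).
Local Notation mu := (@lebesgue_measure R).
Local Notation mu2 := (leb R \x leb R)%E.
Local Notation I := (`]-1, 1[%classic : set R).

Lemma integral_opp (f : R -> \bar R) : measurable_fun [set: R] f ->
  (\int[mu]_x f (- x)%R = \int[mu]_x f x)%E.
Proof.
move=> mf; rewrite integralE [RHS]integralE; congr (_ - _)%E.
  rewrite -[RHS](@ge0_integral_opp R f^\+%E (measurable_funepos mf) (funepos_ge0 f)).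
  by apply: eq_integral => x _; rewrite !funeposE.
rewrite -[RHS](@ge0_integral_opp R f^\-%E (measurable_funeneg mf) (funeneg_ge0 f)).
by apply: eq_integral => x _; rewrite !funenegE.
Qed.

Lemma I_opp x : (I (- x)) = (I x).
Proof.
by apply/propext; rewrite /= !in_itv/= ltrNl opprK ltrNl; split=> /andP[-> ->].
Qed.

Lemma Rintegral_opp_I (f : R -> R) : measurable_fun I f ->
  \int[mu]_(x in I) f (- x) = \int[mu]_(x in I) f x.
Proof.
move=> mf; rewrite /Rintegral; congr fine.
rewrite integral_mkcond [RHS]integral_mkcond -[RHS]integral_opp.
  apply: eq_integral => x _; rewrite !patchE; congr (if _ then _ else _).
  by apply/idP/idP; rewrite !inE -/(I x) -/(I (- x)) I_opp.
apply/(measurable_restrictT _ (@mI R)); exact/measurable_EFinP.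
Qed.

Lemma measurable_opp2 : measurable_fun [set: R * R] (fun z : R * R => (z.1, - z.2)).
Proof.
apply/measurable_fun_pairP; split => /=; first exact: measurable_fst.
exact: (measurable_funN measurable_snd).
Qed.

Lemma measurable_opp1 : measurable_fun [set: R * R] (fun z : R * R => (- z.1, z.2)).
Proof.
apply/measurable_fun_pairP; split => /=; last exact: measurable_snd.
exact: (measurable_funN measurable_fst).
Qed.

Lemma integral2_opp2 (g : R * R -> \bar R) : measurable_fun [set: R * R] g ->
  (forall z, 0 <= g z)%E ->
  (\int[mu2]_z g (z.1, - z.2)%R = \int[mu2]_z g z)%E.
Proof.
move=> mg g0; rewrite [LHS]fubini_tonelli1; first last.
- by move=> z; exact: g0.
- exact: (measurableT_comp mg measurable_opp2).
apply: etrans _ (esym (@fubini_tonelli1 _ _ _ _ R mu mu g mg g0)).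
apply: eq_integral => x _.
rewrite /fubini_F/= (@ge0_integral_opp _ (fun y => g (x, y)))//.
exact: measurableT_comp.
Qed.

Lemma integral2_opp1 (g : R * R -> \bar R) : measurable_fun [set: R * R] g ->
  (forall z, 0 <= g z)%E ->
  (\int[mu2]_z g (- z.1, z.2)%R = \int[mu2]_z g z)%E.
Proof.
move=> mg g0; rewrite [LHS]fubini_tonelli1; first last.
- by move=> z; exact: g0.
- exact: (measurableT_comp mg measurable_opp1).
apply: etrans _ (esym (@fubini_tonelli1 _ _ _ _ R mu mu g mg g0)).
rewrite -[RHS]ge0_integral_opp//; first exact: measurable_fun_fubini_tonelli_F.
by move=> x; apply: integral_ge0.
Qed.

Definition flip u : R -> R := fun x => u (- x).

Lemma measurable_flip u : measurable_fun [set: R] u -> measurable_fun [set: R] (flip u).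
Proof. by move=> mu_; apply: measurableT_comp => //; exact: oppr_measurable. Qed.

Lemma energy_flip u : measurable_fun [set: R] u -> energy (flip u) = energy u.
Proof.
move=> mu_; have mf := measurable_flip mu_; rewrite /energy.
have mg : measurable_fun [set: R * R] (fun z => (gag (flip u) (flip u) z)%:E).
  by apply/measurable_EFinP; exact: measurable_gag.
have g0 z : (0 <= (gag (flip u) (flip u) z)%:E)%E by rewrite lee_fin gag_ge0.
pose h z := (gag (flip u) (flip u) z)%:E.
have mh : measurable_fun [set: R * R] (fun z => h (z.1, - z.2)).
  exact: (measurableT_comp mg measurable_opp2).
apply: etrans (esym (@integral2_opp2 h mg g0)) _.
apply: etrans (esym (@integral2_opp1 (fun z => h (z.1, - z.2)) mh _)) _.
  by move=> z; exact: g0.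
apply: eq_integral => z _; rewrite /h !gagE /flip /= !opprK; congr EFin.
by congr (_ * _^-1); ring.
Qed.

Lemma L2sq_flip u : measurable_fun [set: R] u -> L2sq (flip u) = L2sq u.
Proof.
move=> mu_; rewrite /L2sq /flip (@ge0_integral_opp _ (fun x => (u x ^+ 2)%:E))//.
  by apply/measurable_EFinP; exact: measurable_funX.
by move=> x; rewrite lee_fin sqr_ge0.
Qed.

Lemma ae_opp (P : R -> Prop) : {ae mu, forall x, P x} -> {ae mu, forall x, P (- x)}.
Proof.
move=> [N [mN N0 PN]]; exists ((-%R : R -> measurableTypeR R) @^-1` N); split.
- by rewrite -[X in measurable X]setTI; exact: oppr_measurable.
- by rewrite -N0; exact: (lebesgue_measureN mN).
- by move=> x /= nP; exact: PN.
Qed.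

Lemma H12_flip u : H12 R u -> H12 R (flip u).
Proof.
move=> /H12P[mu_ Lu Eu ou]; apply/H12P; split.
- exact: measurable_flip.
- by rewrite L2sq_flip.
- by rewrite energy_flip.
- apply: (@filterS _ _ ae_filter _ _ _ (ae_opp ou)) => x h nx.
  by apply: h; rewrite -/(I (- x)) I_opp.
Qed.

Lemma form_flip V u : bounded_potential V -> (forall x, V (- x) = V x) -> H12 R u ->
  form V (flip u) (flip u) = form V u u.
Proof.
move=> bV Vev Hu; have [mu_ _ _ _] := (H12P u).1 Hu.
rewrite !formE; congr (_ * _ + _ * _).
  by apply/EFin_inj; rewrite !Gf_energy ?energy_flip//; exact: H12_flip.
have [mV _] := bV.
rewrite /pot -[RHS]Rintegral_opp_I; last first.
  apply: measurable_funM; last exact: measurable_funTS.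
  by apply: measurable_funM => //; exact: measurable_funTS.
by apply: eq_Rintegral => x _; rewrite /flip Vev.
Qed.

Lemma dot_flip u : H12 R u -> dot (flip u) (flip u) = dot u u.
Proof.
move=> Hu; have [mu_ _ _ _] := (H12P u).1 Hu.
by apply/EFin_inj; rewrite !L2sq_dot ?L2sq_flip//; exact: H12_flip.
Qed.

Lemma measurable_absV : measurable_fun [set: R] (fun t : R => `|t|^-1).
Proof.
rewrite (_ : (fun t => _) = (fun t : R => `|t| `^ (- 1))).
  by apply: measurableT_comp (@measurable_powR R _) _; exact: normr_measurable.
by apply/funext => t; rewrite powRN powRr1.
Qed.

(** The reflection [y -> - y] turns the energy density of an odd [u] into
[(u x + u y)^2 / (x + y)^2], and both denominators are at most
[(|x| + |y|)^2].  The sum of the two densities is thus at least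
[2 (u x ^+ 2 + u y ^+ 2) / (|x| + |y|)^2].  Dropping [u y ^+ 2] and integrating
out [y] by [integral_kap] with [a = |x|] bounds twice the energy from below. *)
Lemma hardy u : H12 R u -> (forall x, u (- x) = - u x) ->
  (\int[mu]_x (2 * (u x ^+ 2 / `|x|))%:E <= energy u)%E.
Proof.
move=> Hu uodd; have [mu_ _ _ _] := (H12P u).1 Hu.
have mg : measurable_fun [set: R * R] (EFin \o gag u u).
  by apply/measurable_EFinP; exact: measurable_gag.
have g0 z : (0 <= (gag u u z)%:E)%E by rewrite lee_fin gag_ge0.
(* What remains of the two densities once u y is dropped. *)
pose k (z : R * R) : R := 2 * u z.1 ^+ 2 * ((`|z.1| + `|z.2|) ^+ 2)^-1.
have k0 z : 0 <= k z by rewrite mulr_ge0 ?invr_ge0 ?sqr_ge0// mulr_ge0 ?sqr_ge0.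
have mk : measurable_fun [set: R * R] k.
  apply: measurable_funM.
    apply: measurable_funM; first exact: measurable_cst.
    by apply: measurable_funX; exact: measurableT_comp.
  apply: (measurableT_comp (@measurable_sqV R)).
  by apply: measurable_funD; apply: measurableT_comp => //; exact: normr_measurable.
have kE : (\int[mu2]_z (k z)%:E = \int[mu]_x (2 * (2 * (u x ^+ 2 / `|x|)))%:E)%E.
  rewrite fubini_tonelli1; [|exact/measurable_EFinP|by move=> z; rewrite lee_fin].
  apply: eq_integral => x _; rewrite /fubini_F/k/=.
  (* At x = 0 the kernel degenerates, but an odd function vanishes there. *)
  have [->|x0] := eqVneq x 0.
    have -> : u 0 = 0 by have := uodd 0; rewrite oppr0 => h; lra.
    by rewrite integral0_eq => [|y _]; rewrite !expr0n ?mulr0 !mul0r ?mulr0.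
  have nx : 0 < `|x| by rewrite normr_gt0.
  under eq_integral => y _.
    rewrite (_ : _ * _ = 2 * (u x ^+ 2 / `|x|) * kap `|x| y); last first.
      rewrite /kap; field.
      by rewrite (gt_eqF nx) andbT gt_eqF// ltr_wpDr.
    rewrite EFinM; over.
  rewrite ge0_integralZl_EFin//.
  - by rewrite integral_kap// -EFinM; congr EFin; ring.
  - by move=> y _; rewrite lee_fin kap_ge0.
  - by apply/measurable_EFinP; exact: measurable_kap.
  - by rewrite mulr_ge0// divr_ge0// sqr_ge0.
have m2 : measurable_fun [set: R * R] (fun z => (gag u u (z.1, - z.2))%:E).
  exact: (measurableT_comp mg measurable_opp2).
have : (\int[mu2]_z (k z)%:E <= energy u + energy u)%E.
  rewrite /energy -{2}(integral2_opp2 mg)// -ge0_integralD//; last by move=> z _; exact: g0.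
  apply: ge0_le_integral => //=.
  - by move=> z _; rewrite lee_fin.
  - exact/measurable_EFinP.
  - exact: emeasurable_funD.
  - move=> [x y] _; rewrite -EFinD lee_fin !gagE /k/= uodd !opprK.
    set S := (`|x| + `|y|) ^+ 2.
    (* The hypothesis on e = 0 covers the two lines y = x and y = - x, where the
       quotient is 0 by convention and so must be its numerator. *)
    have tl (a e : R) : (e = 0 -> a = 0) -> `|e| <= `|x| + `|y| ->
        a * a * S^-1 <= a * a * (e ^+ 2)^-1.
      move=> ea eS; have [e0|e0] := eqVneq e 0; first by rewrite ea// !mul0r.
      have e2 : 0 < e ^+ 2 by rewrite exprn_even_gt0//= e0.
      have eS2 : e ^+ 2 <= S.
        by rewrite -real_normK ?num_real// lerXn2r// nnegrE// addr_ge0.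
      by rewrite ler_wpM2l -?expr2 ?sqr_ge0// lef_pV2 ?posrE// (lt_le_trans e2).
    have t1 := tl (u x - u y) (x - y) _ (ler_normB _ _).
    have t2 := tl (u x + u y) (x + y) _ (ler_normD _ _).
    apply: le_trans (lerD (t1 _) (t2 _)).
    + rewrite -mulrDl ler_wpM2r ?invr_ge0 ?sqr_ge0//.
      have := sqr_ge0 (u y); lra.
    + by move=> /eqP; rewrite subr_eq0 => /eqP ->; rewrite subrr.
    + by move=> /eqP; rewrite addr_eq0 => /eqP ->; rewrite uodd addNr.
rewrite kE; have -> : (\int[mu]_x (2 * (2 * (u x ^+ 2 / `|x|)))%:E =
    2%:E * \int[mu]_x (2 * (u x ^+ 2 / `|x|))%:E)%E.
  rewrite -ge0_integralZl_EFin//.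
  - by move=> x _; rewrite lee_fin mulr_ge0// divr_ge0// sqr_ge0.
  - apply/measurable_EFinP; apply: measurable_funM; first exact: measurable_cst.
    by apply: measurable_funM; [exact: measurable_funX|exact: measurable_absV].
rewrite -Gf_energy// -EFinD -mulr2n -[Gf u u *+ 2]mulr_natl EFinM.
by rewrite lee_pmul2l// lte_fin.
Qed.

End Parity.

(** * A regularised Hardy potential *)

Section Well.
Context {R : realType}.
Implicit Types (u v w f V : R -> R).
Local Notation mu := (@lebesgue_measure R).
Local Notation mu2 := (leb R \x leb R)%E.
Local Notation I := (`]-1, 1[%classic : set R).
Local Notation c := (c_frac (2^-1 : R)).

(** The coupling constant is the largest for which the form stays nonnegative on
odd functions by [hardy]; the truncation at [e] makes the potential bounded. *)
Definition well (e x : R) : R := - (c / Num.max `|x| e).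

Lemma max_gt0 (e x : R) : 0 < e -> 0 < Num.max `|x| e.
Proof. by move=> e0; rewrite lt_max e0 orbT. Qed.

Lemma measurable_well e : 0 < e -> measurable_fun [set: R] (well e).
Proof.
move=> e0; apply: measurable_funN; apply: measurable_funM; first exact: measurable_cst.
rewrite (_ : (fun x => _) = (fun t : R => `|t|^-1) \o (fun x => Num.max `|x| e)).
  apply: (measurableT_comp (@measurable_absV R)).
  by apply: measurable_maxr; [exact: normr_measurable|exact: measurable_cst].
by apply/funext => x /=; rewrite [X in _ = X^-1]ger0_norm// ltW// max_gt0.
Qed.

Lemma well_le e x : 0 < e -> `|well e x| <= c / e.
Proof.
move=> e0; have c0 := @c_frac_gt0 R.
rewrite normrN ger0_norm; last by rewrite divr_ge0// ltW// max_gt0.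
by rewrite ler_wpM2l ?(ltW c0)// lef_pV2 ?posrE ?max_gt0// le_max lexx orbT.
Qed.

Lemma bdd_well e : 0 < e -> bounded_potential (well e).
Proof.
move=> e0; split; first by apply: measurable_funTS; exact: measurable_well.
by exists (c / e) => x _; exact: well_le.
Qed.

Lemma well_even e x : well e (- x) = well e x.
Proof. by rewrite /well normrN. Qed.

Lemma pot_wellE (e : R) u : 0 < e -> H12 R u ->
  (- pot (well e) u u)%:E = (\int[mu]_(x in I) (c / Num.max `|x| e * u x ^+ 2)%:E)%E.
Proof.
move=> e0 Hu; have iV := pot_int (bdd_well e0) Hu Hu.
rewrite /pot /Rintegral EFinN fineK; last exact: integrable_fin_num iV.
rewrite -(oppeK (\int[mu]_(x in I) (c / _ * _)%:E)%E); congr (- _)%E.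
rewrite -integral_ge0N; last first.
  move=> x _; rewrite lee_fin mulr_ge0 ?sqr_ge0//.
  by rewrite divr_ge0// ltW ?c_frac_gt0 ?max_gt0.
by apply: eq_integral => x _; rewrite -EFinN; congr EFin; rewrite /well; ring.
Qed.

Lemma form_odd_ge0 (e : R) u : 0 < e -> H12 R u -> (forall x, u (- x) = - u x) ->
  0 <= form (well e) u u.
Proof.
move=> e0 Hu uodd; have [mu_ _ _ _] := (H12P u).1 Hu.
have c0 := @c_frac_gt0 R.
rewrite formE mul1r -lerBlDr sub0r -lee_fin pot_wellE//.
apply: (@le_trans _ _ (\int[mu]_x ((c / 2) * (2 * (u x ^+ 2 / `|x|)))%:E)%E).
  rewrite integral_mkcond; apply: ge0_le_integral => //.
  - move=> x _; rewrite patchE; case: ifP => // _.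
    by rewrite lee_fin mulr_ge0 ?sqr_ge0// divr_ge0// ltW// max_gt0.
  - apply/(measurable_restrictT _ (@mI R))/measurable_EFinP.
    rewrite (_ : (fun x => _) = (fun x => - well e x * u x ^+ 2)).
      apply: measurable_funM; last by apply: measurable_funX; exact: measurable_funTS.
      by apply: measurable_funN; apply: measurable_funTS; exact: measurable_well.
    by apply/funext => x; rewrite /well opprK.
  - apply/measurable_EFinP; apply: measurable_funM; first exact: measurable_cst.
    apply: measurable_funM; first exact: measurable_cst.
    by apply: measurable_funM; [exact: measurable_funX|exact: measurable_absV].
  - move=> x _; rewrite patchE; case: ifP => _; last first.
      by rewrite lee_fin mulr_ge0 ?divr_ge0 ?(ltW c0)// mulr_ge0// divr_ge0// sqr_ge0.
    rewrite lee_fin; have [->|x0] := eqVneq x 0.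
      have -> : u 0 = 0 by have := uodd 0; rewrite oppr0 => h; lra.
      by rewrite expr0n mulr0 mul0r !mulr0.
    have nx : 0 < `|x| by rewrite normr_gt0.
    rewrite (_ : c / 2 * _ = c / `|x| * u x ^+ 2); last by field; rewrite gt_eqF.
    rewrite ler_wpM2r ?sqr_ge0// ler_wpM2l ?(ltW c0)//.
    by rewrite lef_pV2 ?posrE ?max_gt0// le_max lexx.
under eq_integral do rewrite EFinM.
rewrite ge0_integralZl_EFin//; first last.
- by rewrite divr_ge0// ltW.
- apply/measurable_EFinP; apply: measurable_funM; first exact: measurable_cst.
  by apply: measurable_funM; [exact: measurable_funX|exact: measurable_absV].
- by move=> x _; rewrite lee_fin mulr_ge0// divr_ge0// sqr_ge0.
rewrite [leRHS]EFinM lee_wpmul2l ?lee_fin ?divr_ge0 ?(ltW c0)//.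
by rewrite Gf_energy//; exact: hardy.
Qed.

(** Equal to 1 on [|x| <= r / 3] and to 0 on [|x| >= r].  Interpolating by
[r / (r + |x|)] instead of [|x|] makes its increments between any two points
comparable to [r * |x - y| / ((r + |x|) * (r + |y|))], also at long range. *)
Definition cutoff (r x : R) : R :=
  Num.min 1 (Num.max 0 (4 * (r / (r + `|x|)) - 2)).

Lemma measurable_cutoff r : 0 < r -> measurable_fun [set: R] (cutoff r).
Proof.
move=> r0; apply: measurable_minr; first exact: measurable_cst.
apply: measurable_maxr; first exact: measurable_cst.
apply: measurable_funB; last exact: measurable_cst.
apply: measurable_funM; first exact: measurable_cst.
apply: measurable_funM; first exact: measurable_cst.
rewrite (_ : (fun x => _) = (fun t : R => `|t|^-1) \o (fun x => r + `|x|)).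
  apply: (measurableT_comp (@measurable_absV R)).
  by apply: measurable_funD; [exact: measurable_cst|exact: normr_measurable].
by apply/funext => x /=; rewrite [X in _ = X^-1]ger0_norm// ltW// denom_gt0.
Qed.

Lemma cutoff_ge0 r x : 0 <= cutoff r x.
Proof. by rewrite le_min ler01 le_max lexx. Qed.

Lemma cutoff_le1 r x : cutoff r x <= 1.
Proof. by rewrite ge_min lexx. Qed.

Lemma cutoff0 r x : 0 < r -> r <= `|x| -> cutoff r x = 0.
Proof.
move=> r0 rx; rewrite /cutoff max_l ?min_r//.
have : r / (r + `|x|) <= 2^-1 by rewrite ler_pdivrMr ?denom_gt0//; lra.
by lra.
Qed.

Lemma cutoff1 r x : 0 < r -> `|x| <= r / 3 -> cutoff r x = 1.
Proof.
move=> r0 rx; rewrite /cutoff min_l// le_max; apply/orP; right.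
have : 3 / 4 <= r / (r + `|x|) by rewrite ler_pdivlMr ?denom_gt0//; lra.
by lra.
Qed.

Lemma clamp_lip (a b : R) : `|Num.min 1 (Num.max 0 a) - Num.min 1 (Num.max 0 b)| <= `|a - b|.
Proof.
wlog ab : a b / b <= a => [h|].
  by have [/h//|/ltW/h] := leP b a; rewrite distrC [leRHS]distrC.
rewrite [leRHS]ger0_norm ?subr_ge0// ger0_norm; last first.
  by rewrite subr_ge0 !le_min !ge_min !ge_max !le_max ab !lexx !orbT.
case: (leP 0 a) => ?; case: (leP 0 b) => ?; case: (leP 1 _) => ?;
  by try case: (leP 1 _) => ?; lra.
Qed.

(** The factor [(x - y)^2] cancels, which leaves a product of two kernels of
scale [r]; the 16 is the square of the slope 4 of the cutoff. *)
Lemma gag_cutoff r z : 0 < r ->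
  gag (cutoff r) (cutoff r) z <= 16 * (kap r z.1 * kap r z.2).
Proof.
move: z => [x y] r0; rewrite gagE/=.
have [->|xy] := eqVneq x y.
  by rewrite !subrr mulr0 mul0r mulr_ge0// mulr_ge0// kap_ge0.
have xy0 : 0 < (x - y) ^+ 2 by rewrite exprn_even_gt0//= subr_eq0.
rewrite ler_pdivrMr// -expr2 -real_normK ?num_real//.
have rx := denom_gt0 x r0; have ry := denom_gt0 y r0.
have h : `|cutoff r x - cutoff r y| <= 4 * r * `|x - y| / ((r + `|x|) * (r + `|y|)).
  apply: le_trans (clamp_lip _ _) _.
  rewrite (_ : _ - _ = 4 * r * (`|y| - `|x|) / ((r + `|x|) * (r + `|y|))); last first.
    by field; rewrite !gt_eqF.
  rewrite normrM [X in _ * X]ger0_norm ?invr_ge0 ?mulr_ge0 ?(ltW rx) ?(ltW ry)//.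
  rewrite ler_wpM2r ?invr_ge0 ?mulr_ge0 ?(ltW rx) ?(ltW ry)//.
  rewrite normrM [X in X * _ <= _]ger0_norm ?mulr_ge0 ?(ltW r0)//.
  by rewrite ler_wpM2l ?mulr_ge0 ?(ltW r0)// distrC; exact: ler_dist_dist.
apply: (@le_trans _ _ ((4 * r * `|x - y| / ((r + `|x|) * (r + `|y|))) ^+ 2)).
  rewrite lerXn2r// nnegrE//; apply: divr_ge0; last first.
    by rewrite mulr_ge0 ?(ltW rx) ?(ltW ry).
  by rewrite mulr_ge0// mulr_ge0// ltW.
rewrite -[in leRHS]real_normK ?num_real// /kap le_eqVlt; apply/orP; left; apply/eqP.
by field; rewrite !gt_eqF.
Qed.

(** The bound does not depend on [r]: it is [16 * 2 * 2], where each 2 is the mass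
of [kap r]. *)
Lemma energy_cutoff r : 0 < r -> (energy (cutoff r) <= 64%:E)%E.
Proof.
move=> r0; have mk := measurable_kap r0; have mc := measurable_cutoff r0.
have mkk : measurable_fun [set: R * R] (fun z : R * R => 16 * (kap r z.1 * kap r z.2)).
  apply: measurable_funM; first exact: measurable_cst.
  by apply: measurable_funM; apply: measurableT_comp.
have kk0 z : 0 <= 16 * (kap r z.1 * kap r z.2) by rewrite mulr_ge0// mulr_ge0// kap_ge0.
apply: (@le_trans _ _ (\int[mu2]_z (16 * (kap r z.1 * kap r z.2))%:E)%E).
  apply: ge0_le_integral => //=.
  - by move=> z _; rewrite lee_fin gag_ge0.
  - by apply/measurable_EFinP; exact: measurable_gag.
  - exact/measurable_EFinP.
  - by move=> z _; rewrite lee_fin gag_cutoff.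
rewrite (@fubini_tonelli1 _ _ _ _ R mu mu)//; [|exact/measurable_EFinP].
rewrite /fubini_F/=.
under eq_integral => x _.
  under eq_integral => y _ do rewrite mulrA EFinM.
  rewrite ge0_integralZl_EFin//; last 3 first.
  - by move=> y _; rewrite lee_fin kap_ge0.
  - exact/measurable_EFinP.
  - by rewrite mulr_ge0// kap_ge0.
  rewrite integral_kap// -EFinM (_ : _ * 2 = 32 * kap r x); last by ring.
  rewrite EFinM; over.
rewrite ge0_integralZl_EFin//; last 2 first.
- by move=> y _; rewrite lee_fin kap_ge0.
- exact/measurable_EFinP.
by rewrite integral_kap// -EFinM lee_fin; lra.
Qed.

Lemma H12_cutoff r : 0 < r <= 1 -> H12 R (cutoff r).
Proof.
move=> /andP[r0 r1]; apply/H12P; split.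
- exact: measurable_cutoff.
- apply: (@le_lt_trans _ _ (\int[mu]_x ((4 * r) * kap r x)%:E)%E).
    apply: ge0_le_integral => //=.
    + by move=> x _; rewrite lee_fin sqr_ge0.
    + by apply/measurable_EFinP; apply: measurable_funX; exact: measurable_cutoff.
    + apply/measurable_EFinP; apply: measurable_funM; first exact: measurable_cst.
      exact: measurable_kap.
    + move=> x _; rewrite lee_fin; have [rx|rx] := leP r `|x|.
        by rewrite cutoff0// expr0n mulr_ge0 ?kap_ge0// mulr_ge0// ltW.
      apply: (@le_trans _ _ 1); first by rewrite exprn_ile1// ?cutoff_ge0 ?cutoff_le1.
      rewrite /kap mulrA ler_pdivlMr ?exprn_gt0 ?denom_gt0// mul1r.
      have := normr_ge0 x; nra.
  under eq_integral do rewrite EFinM.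
  rewrite ge0_integralZl_EFin//; last 3 first.
  - by move=> y _; rewrite lee_fin kap_ge0.
  - by apply/measurable_EFinP; exact: measurable_kap.
  - by rewrite mulr_ge0// ltW.
  by rewrite integral_kap// -EFinM ltry.
- by rewrite (le_lt_trans (energy_cutoff r0))// ltry.
- apply: (@filterE _ _ ae_filter) => x nIx; apply: cutoff0 => //.
  rewrite leNgt; apply/negP => xr; apply: nIx => /=.
  by rewrite in_itv/= -ltr_norml (lt_le_trans xr).
Qed.

Lemma integral_inv (a b : R) : 0 < a -> a < b ->
  (\int[mu]_(x in `[a, b]) (x^-1)%:E = (ln b - ln a)%:E)%E.
Proof.
move=> a0 ab; rewrite EFinB; apply: continuous_FTC2 => //.
- apply: continuous_in_subspaceT => x; rewrite inE/= in_itv/= => /andP[ax _].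
  by apply: inv_continuous; rewrite gt_eqF// (lt_le_trans a0).
- split.
  + move=> x; rewrite in_itv/= => /andP[ax _].
    by have [] := is_derive1_ln (lt_trans a0 ax).
  + by apply: cvg_at_right_filter; exact: continuous_ln.
  + by apply: cvg_at_left_filter; apply: continuous_ln; exact: lt_trans ab.
- move=> x; rewrite in_itv/= => /andP[ax _]; rewrite derive1E.
  by have [] := is_derive1_ln (lt_trans a0 ax).
Qed.

(** Supported in [r / 3 <= |x| <= s] and equal to 1 on [r <= |x| <= s / 3]. *)
Definition annulus (r s : R) : R -> R := lin 1 (cutoff s) (-1) (cutoff r).

Lemma annulus_out r s x : 0 < r -> r <= s -> `|x| <= r / 3 -> annulus r s x = 0.
Proof.
move=> r0 rs xr; rewrite /annulus /lin !cutoff1//; first ring.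
  exact: lt_le_trans rs.
by rewrite (le_trans xr)// ler_pM2r.
Qed.

Lemma annulus_far r s x : 0 < r -> r <= s -> s <= `|x| -> annulus r s x = 0.
Proof.
move=> r0 rs xr; rewrite /annulus /lin !cutoff0//; [ring|exact: le_trans xr|].
exact: lt_le_trans rs.
Qed.

Lemma annulus_in r s x : 0 < r -> r <= `|x| <= s / 3 -> annulus r s x = 1.
Proof.
move=> r0 /andP[rx xs]; rewrite /annulus /lin cutoff1// ?cutoff0//; first ring.
have : 0 < s / 3 by apply: lt_le_trans xs; exact: lt_le_trans rx.
by rewrite pmulr_lgt0.
Qed.

Lemma H12_annulus r s : 0 < r -> r <= s -> s <= 1 -> H12 R (annulus r s).
Proof.
move=> r0 rs s1; apply: H12_lin; apply: H12_cutoff.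
  by rewrite s1 (lt_le_trans r0).
by rewrite r0 (le_trans rs).
Qed.

Lemma Gf_annulus r s : 0 < r -> r <= s -> s <= 1 ->
  Gf (annulus r s) (annulus r s) <= 256.
Proof.
move=> r0 rs s1; have s0 := lt_le_trans r0 rs.
rewrite -lee_fin Gf_energy; last exact: H12_annulus.
have ms := measurable_cutoff s0; have mr := measurable_cutoff r0.
apply: le_trans (energy_lin_le _ _ ms mr) _.
rewrite sqrrN !expr1n mulr1.
apply: (@le_trans _ _ (2%:E * 64%:E + 2%:E * 64%:E)%E).
  by apply: leeD; apply: lee_wpmul2l; rewrite ?lee_fin//; exact: energy_cutoff.
by rewrite -!EFinM -EFinD lee_fin; lra.
Qed.

(** On [r <= x <= s / 3] the function is 1 and the truncation is inactive; the
mirror interval is not counted. *)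
Lemma pot_annulus e r s : 0 < e -> e <= r -> 3 * r < s -> s <= 1 ->
  pot (well e) (annulus r s) (annulus r s) <= - (c * (ln (s / 3) - ln r)).
Proof.
move=> e0 er rs s1; have r0 := lt_le_trans e0 er.
have c0 := @c_frac_gt0 R.
have H : H12 R (annulus r s) by apply: H12_annulus => //; lra.
have rs3 : r < s / 3 by lra.
have mw := measurable_well e0.
have [ma _ _ _] := (H12P _).1 H.
rewrite lerNr -lee_fin pot_wellE// EFinM -integral_inv// -ge0_integralZl_EFin//; last 3 first.
- move=> x; rewrite /= in_itv/= => /andP[rx _].
  by rewrite lee_fin invr_ge0 (le_trans (ltW r0)).
- apply/measurable_EFinP.
  apply: (eq_measurable_fun (fun x : R => `|x|^-1)).
    move=> x; rewrite inE/= in_itv/= => /andP[rx _].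
    by rewrite ger0_norm// (le_trans (ltW r0)).
  by apply: measurable_funTS; exact: measurable_absV.
- exact: ltW.
have mf : measurable_fun [set: R] (fun x => (c / Num.max `|x| e * annulus r s x ^+ 2)%:E).
  apply/measurable_EFinP.
  rewrite (_ : (fun x => _) = (fun x => - well e x * annulus r s x ^+ 2)).
    by apply: measurable_funM; [exact: measurable_funN|exact: measurable_funX].
  by apply/funext => x; rewrite /well opprK.
have f0 x : (0 <= (c / Num.max `|x| e * annulus r s x ^+ 2)%:E)%E.
  by rewrite lee_fin mulr_ge0 ?sqr_ge0// divr_ge0// ltW// max_gt0.
apply: (@le_trans _ _ (\int[mu]_(x in `[r, (s / 3)%R]) (c / Num.max `|x| e * annulus r s x ^+ 2)%:E)%E).
  rewrite le_eqVlt; apply/orP; left; apply/eqP; apply: eq_integral => x.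
  rewrite inE/= in_itv/= => /andP[rx xs].
  have nx : `|x| = x by rewrite ger0_norm// (le_trans (ltW r0)).
  rewrite annulus_in ?nx ?rx// expr1n mulr1 -EFinM; congr (_ * _^-1)%:E.
  by rewrite max_l// (le_trans er).
apply: ge0_subset_integral => //.
- exact: measurable_funTS.
- move=> x; rewrite /= !in_itv/= => /andP[rx xs].
  by apply/andP; split; lra.
Qed.

(** The two functions live on concentric annuli with the same ratio of radii,
which makes the logarithm equal to [L].  It only has to exceed the bound 256 of
the Gagliardo form of an annulus.  Here the coefficient of [Gf] is [c], twice
that of [form]: the missing half will pay for the interaction of the two
functions, as the energy is not local. *)
Lemma two_negative : exists e, 0 < e /\ exists w1 w2,
  [/\ H12 R w1, H12 R w2, (forall x, w1 x * w2 x = 0),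
     c * Gf w1 w1 + pot (well e) w1 w1 < 0 &
     c * Gf w2 w2 + pot (well e) w2 w2 < 0].
Proof.
have c0 := @c_frac_gt0 R.
have [L L0 L256] : exists2 L : R, 0 < L & 256 < L by exists 257; lra.
pose q : R := expR (- L) / 3.
have q0 : 0 < q by rewrite divr_gt0// expR_gt0.
have q3 : 3 * q < 1.
  by rewrite /q mulrCA divff// mulr1 -[ltRHS]expR0 ltr_expR oppr_lt0.
have neg e r s : 0 < e -> e <= r -> 0 < s -> s <= 1 -> r = q * s ->
    c * Gf (annulus r s) (annulus r s) + pot (well e) (annulus r s) (annulus r s) < 0.
  move=> e0 er s0 s1 rE; have r0 := lt_le_trans e0 er.
  have rs : 3 * r < s by rewrite rE mulrA gtr_pMl.
  have rs' : r <= s by lra.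
  have h1 := pot_annulus e0 er rs s1.
  have h2 := ler_wpM2l (ltW c0) (Gf_annulus r0 rs' s1).
  have hl : ln (s / 3) - ln r = L.
    rewrite -ln_div ?posrE ?divr_gt0//.
    rewrite (_ : s / 3 / r = expR L) ?expRK// rE /q expRN.
    by field; rewrite (lt0r_neq0 s0) (lt0r_neq0 (expR_gt0 _)).
  have := ler_wpM2l (ltW c0) (ltW L256); rewrite hl in h1.
  have : c * 256 < c * L by rewrite ltr_pM2l.
  lra.
(* The outer function is supported in q / 3 <= |x| <= 1, the inner one in
   |x| <= q / 3.  The truncation parameter is the smallest radius on which the
   logarithm relies. *)
pose r1 := q; pose s2 := q / 3; pose r2 := q * s2.
have s20 : 0 < s2 by rewrite divr_gt0.
have r20 : 0 < r2 by rewrite mulr_gt0.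
have r2s2 : r2 <= s2 by rewrite /r2 ger_pMl//; lra.
exists r2; split => //; exists (annulus r1 1), (annulus r2 s2); split.
- by apply: H12_annulus => //; rewrite /r1; lra.
- by apply: H12_annulus => //; rewrite /s2; lra.
- move=> x; have [xs|sx] := leP `|x| s2.
    by rewrite (@annulus_out r1)// ?mul0r// /r1; lra.
  by rewrite (@annulus_far r2) ?mulr0// ltW.
- by apply: neg; rewrite // ?mulr1// /r1; rewrite /s2 in r2s2 *; lra.
- by apply: neg => //; rewrite /s2; lra.
Qed.

(** Since [Gf (a w1 + b w2) <= 2 (a^2 Gf w1 w1 + b^2 Gf w2 w2)] and [w1 w2 = 0],
the form is negative definite on the span of [w1] and [w2], and the plane meets
the complement of any [f]. *)
Lemma negative_orth : exists e, 0 < e /\ forall f, H12 R f -> exists w,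
  [/\ H12 R w, dot w f = 0, 0 < dot w w & form (well e) w w < 0].
Proof.
have c0 := @c_frac_gt0 R.
have [e [e0 [w1 [w2 [H1 H2 w12 n1 n2]]]]] := two_negative.
exists e; split => // f Hf; have bV := bdd_well e0.
have bF := bilin_form bV; have [M FM] := form_ge bV.
have P12 : pot (well e) w1 w2 = 0.
  transitivity (\int[mu]_(x in I) (0 : R)).
    by apply: eq_Rintegral => x _; rewrite -mulrA w12 mulr0.
  by rewrite Rintegral_cst ?mul0r//; exact: mI.
have neg a b : (a != 0) || (b != 0) -> form (well e) (lin a w1 b w2) (lin a w1 b w2) < 0.
  move=> ab; rewrite (bilin_quad _ _ bF)// !formE P12.
  (* Nonnegativity at a w1 - b w2 bounds the cross term at a w1 + b w2. *)
  have := Gf_ge0 (lin a w1 (- b) w2); rewrite (bilin_quad _ _ bilin_Gf)// => h.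
  have h' := mulr_ge0 (ltW c0) h.
  have a2 := sqr_ge0 a; have b2 := sqr_ge0 b.
  have : a ^+ 2 * (c * Gf w1 w1 + pot (well e) w1 w1) +
         b ^+ 2 * (c * Gf w2 w2 + pot (well e) w2 w2) < 0.
    case/orP: ab => ab.
      have a2' : 0 < a ^+ 2 by rewrite exprn_even_gt0//= ab.
      have := ler_wpM2l b2 (ltW n2); have := n1; rewrite -(pmulr_rlt0 _ a2'); lra.
    have b2' : 0 < b ^+ 2 by rewrite exprn_even_gt0//= ab.
    have := ler_wpM2l a2 (ltW n1); have := n2; rewrite -(pmulr_rlt0 _ b2'); lra.
  by lra.
have pos w : H12 R w -> form (well e) w w < 0 -> 0 < dot w w.
  move=> Hw n; rewrite lt_neqAle dot_ge0 andbT eq_sym; apply/eqP => w0.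
  by have := FM _ Hw; rewrite w0 mulr0 leNgt n.
have [a [b [ab abf]]] : exists a b, ((a != 0) || (b != 0)) /\
    a * dot w1 f + b * dot w2 f = 0.
  have [d2|d2] := eqVneq (dot w2 f) 0.
    by exists 0, 1; rewrite oner_eq0 orbT d2 mul0r mulr0 addr0.
  exists (dot w2 f), (- dot w1 f); rewrite d2; split => //; ring.
exists (lin a w1 b w2); split; [exact: H12_lin|by rewrite dot_lin| |exact: neg].
by apply: pos; [exact: H12_lin|exact: neg].
Qed.

End Well.

(** * Parity and sign of the first two eigenfunctions *)

Section Signs.
Context {R : realType}.
Implicit Types (u v w p f V : R -> R).
Local Notation mu := (@lebesgue_measure R).
Local Notation mu2 := (leb R \x leb R)%E.
Local Notation I := (`]-1, 1[%classic : set R).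

(** Testing the equation of [u] with [p = u - flip u] gives [form p p = l * dot p p],
because the form and the product are invariant under reflection.  The left side
is nonnegative since [p] is odd, while [l < 0]. *)
Lemma negative_even e (l : R) u : 0 < e -> l < 0 ->
  frac_eigenspace 2^-1 `]-1, 1[ (well e) l u -> ae_zero (fun x => u x - u (- x)).
Proof.
move=> e0 l0 [Hu eu]; have bV := @bdd_well R _ e0; have bF := bilin_form bV.
have Hf := H12_flip Hu; pose p := lin 1 u (-1) (flip u).
have Hp : H12 R p by exact: H12_lin.
have podd x : p (- x) = - p x by rewrite /p /lin /flip opprK; ring.
have Fp : form (well e) p p = 2 * form (well e) u p.
  have Ff := form_flip bV (well_even e) Hu.
  rewrite /p (bilin_quad _ _ bF)// Ff (bilin_r _ _ bF)//; ring.
have dp : dot p p = 2 * dot u p.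
  by rewrite /p (bilin_quad _ _ bilin_dot)// dot_flip// (bilin_r _ _ bilin_dot)//; ring.
have : form (well e) u p = l * dot u p by exact: eu.
have := form_odd_ge0 e0 Hp podd; rewrite Fp => h1 h2.
have : dot p p = 0.
  by apply/eqP; rewrite eq_le dot_ge0 andbT dp; nra.
move/(ae_zeroP Hp); apply: (@filterS _ _ ae_filter) => x.
by rewrite /p /lin /flip mul1r mulN1r.
Qed.

Lemma continuous_ae_zero (g : R -> R) : continuous g -> ae_zero g -> forall x, g x = 0.
Proof.
move=> cg [N [mN N0 gN]] x; apply/eqP; apply/negP => gx.
have : \forall y \near x, g y != 0.
  by have := cg x; move=> /cvgr_neq0; apply; exact/negP.
move=> /nbhs_ballP[r /= r0 br].
have : (mu (ball x r) <= mu N)%E.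
  apply: le_measure; rewrite ?inE//; first exact: measurable_ball.
  by move=> y xy; apply: gN => /= gy; have := br _ xy; rewrite gy eqxx.
rewrite N0 lebesgue_measure_ball ?(ltW r0)// lee_fin leNgt; apply/negP/negPn.
by rewrite mulrn_wgt0.
Qed.

Definition absf u : R -> R := fun x => `|u x|.

Lemma gag_abs u z : gag (absf u) (absf u) z <= gag u u z.
Proof.
rewrite !gagE ler_wpM2r ?invr_ge0 ?sqr_ge0// -!expr2 -real_normK ?num_real//.
rewrite -[leRHS]real_normK ?num_real// lerXn2r ?nnegrE//.
exact: ler_dist_dist.
Qed.

Lemma H12_abs u : H12 R u -> H12 R (absf u).
Proof.
move=> /H12P[mu_ Lu Eu ou].
have ma : measurable_fun [set: R] (absf u) by exact: measurableT_comp.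
apply/H12P; split => //.
- rewrite (_ : L2sq (absf u) = L2sq u)//; apply: eq_integral => x _.
  by rewrite /absf real_normK ?num_real.
- apply: le_lt_trans Eu; apply: ge0_le_integral => //=.
  + by move=> z _; rewrite lee_fin gag_ge0.
  + by apply/measurable_EFinP; exact: measurable_gag.
  + by apply/measurable_EFinP; exact: measurable_gag.
  + by move=> z _; rewrite lee_fin gag_abs.
- by apply: (@filterS _ _ ae_filter _ _ _ ou) => x h /h; rewrite /absf => ->; rewrite normr0.
Qed.

Lemma dot_abs u : dot (absf u) (absf u) = dot u u.
Proof. by apply: eq_Rintegral => x _; rewrite -!expr2 real_normK ?num_real. Qed.

Lemma form_abs V u : H12 R u -> form V (absf u) (absf u) <= form V u u.
Proof.
move=> Hu; have Ha := H12_abs Hu; rewrite !formE lerD//.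
  apply: ler_wpM2l; first by rewrite divr_ge0// ltW// c_frac_gt0.
  apply: le_Rintegral => //; [exact: gag_int|exact: gag_int|].
  by move=> z _; exact: gag_abs.
rewrite !mul1r le_eqVlt; apply/orP; left; apply/eqP.
by apply: eq_Rintegral => x _; rewrite -!mulrA -!expr2 real_normK ?num_real.
Qed.

Lemma dot0_ae u p : H12 R u -> H12 R p -> (forall x, I x -> 0 <= u x) ->
  (forall x, 0 <= p x) -> dot p u = 0 -> {ae mu, forall x, p x * u x = 0}.
Proof.
move=> Hu Hp u0 p0 pu.
have [mp _ _ op] := (H12P p).1 Hp; have [mu_ _ _ _] := (H12P u).1 Hu.
have mpu : measurable_fun I (fun x => (p x * u x)%:E).
  by apply/measurable_EFinP; apply: measurable_funTS; exact: measurable_funM.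
have ii := dot_int Hp Hu.
have : (\int[mu]_(x in I) `|(p x * u x)%:E| = 0)%E.
  transitivity (\int[mu]_(x in I) (p x * u x)%:E)%E.
    apply: eq_integral => x; rewrite inE => Ix.
    by rewrite gee0_abs// lee_fin mulr_ge0// u0.
  by rewrite -[LHS]fineK; [congr EFin; exact: pu|exact: integrable_fin_num ii].
move/(ae_eq_integral_abs mu (@mI R) mpu) => h.
apply: (@filterS2 _ _ ae_filter _ _ _ _ h op) => x h1 h2.
have [Ix|nIx] := pselect (I x); first by have [] := h1 Ix.
by rewrite h2// mul0r.
Qed.

(** The nonlocality at work: nonnegative [p] and [u] with [p u = 0] almost everywhere
have potential term 0, so the equation leaves [Gf p u = 0].  Its density
is then [- (p x * u y + p y * u x) / (x - y)^2], of one sign, so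
[p x * u y = 0] for almost every pair, against [dot p p * dot u u > 0]. *)
Lemma no_orthogonal_signed V (m : R) u p : bounded_potential V -> H12 R u -> H12 R p ->
  (forall x, I x -> 0 <= u x) -> (forall x, 0 <= p x) ->
  dot p u = 0 -> form V p u = m * dot p u -> 0 < dot u u -> 0 < dot p p -> False.
Proof.
move=> bV Hu Hp u0 p0 pu fpu u2 p2.
have [mp _ _ op] := (H12P p).1 Hp; have [mu_ _ _ ou] := (H12P u).1 Hu.
have aepu := dot0_ae Hu Hp u0 p0 pu.
have aeu0 : {ae mu, forall x, 0 <= u x}.
  apply: (@filterS _ _ ae_filter _ _ _ ou) => x h.
  by have [/u0//|/h ->] := pselect (I x).
have P0 : pot V p u = 0.
  transitivity (\int[mu]_(x in I) (0 : R)); last first.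
    by rewrite Rintegral_cst ?mul0r//; exact: mI.
  rewrite /pot /Rintegral; congr fine; apply: ae_eq_integral; first exact: mI.
  - exact: (measurable_int _ (pot_int bV Hp Hu)).
  - exact: measurable_cst.
  - by apply: (@filterS _ _ ae_filter _ _ _ aepu) => x h _; rewrite -mulrA h mulr0.
have G0 : Gf p u = 0.
  move: fpu; rewrite pu mulr0 formE P0 mulr0 addr0 => /eqP.
  rewrite mulf_eq0 => /orP[|/eqP//]; rewrite gt_eqF//.
  by rewrite divr_gt0// c_frac_gt0.
have F2 : Filter (almost_everywhere mu2) by exact: (@ae_filter_ringOfSetsType _ _ _ mu2).
have ig := gag_int Hp Hu.
have mg : measurable_fun [set: R * R] (EFin \o gag p u) by exact: measurable_int ig.
have aeg : \forall z \ae mu2, p z.1 * u z.1 = 0 /\ p z.2 * u z.2 = 0.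
  exact: (@ae_prod R (fun x => p x * u x = 0) aepu).
have aeu : \forall z \ae mu2, 0 <= u z.1 /\ 0 <= u z.2.
  exact: (@ae_prod R (fun x => 0 <= u x) aeu0).
have gE z : p z.1 * u z.1 = 0 -> p z.2 * u z.2 = 0 ->
    gag p u z = - ((p z.1 * u z.2 + p z.2 * u z.1) * ((z.1 - z.2) ^+ 2)^-1).
  move=> h1 h2; rewrite gagE -mulNr; congr (_ * _).
  by rewrite mulrBl !mulrBr h1 h2; ring.
have absg0 : (\int[mu2]_z `|(gag p u z)%:E| = 0)%E.
  transitivity (\int[mu2]_z - (gag p u z)%:E)%E.
    apply: ae_eq_integral => //.
    - by apply: measurableT_comp.
    - by apply: measurableT_comp.
    - apply: filterS2 aeg aeu => z [h1 h2] [h3 h4] _.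
      rewrite gE// EFinN oppeK abseN gee0_abs// lee_fin.
      by rewrite mulr_ge0 ?invr_ge0 ?sqr_ge0// addr_ge0// mulr_ge0.
  have E : (\int[mu2]_z (gag p u z)%:E = 0)%E.
    by rewrite -[LHS]fineK; [congr EFin; exact: G0|exact: integrable_fin_num ig].
  by rewrite integralN ?E ?oppe0//; exact: integrable_add_def ig.
have aeq : \forall z \ae mu2, p z.1 * u z.2 = 0.
  have := (ae_eq_integral_abs mu2 measurableT mg).1 absg0 => h.
  apply: filterS3 h aeg aeu => z hz [h1 h2] [h3 h4].
  have [zE|zE] := eqVneq z.1 z.2; first by rewrite -zE.
  have d0 : 0 < (z.1 - z.2) ^+ 2 by rewrite exprn_even_gt0//= subr_eq0.
  have [/eqP] := hz Logic.I; rewrite gE// oppr_eq0 mulf_eq0 invr_eq0 (gt_eqF d0) orbF.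
  by rewrite paddr_eq0 ?mulr_ge0// => /andP[/eqP].
have : (\int[mu2]_z (p z.1 ^+ 2 * u z.2 ^+ 2)%:E = 0)%E.
  have mq : measurable_fun [set: R * R] (fun z : R * R => (p z.1 ^+ 2 * u z.2 ^+ 2)%:E).
    apply/measurable_EFinP; apply: measurable_funM; apply: measurable_funX;
      exact: measurableT_comp.
  transitivity (\int[mu2]_z (0%E : \bar R))%E; last by rewrite integral0.
  apply: ae_eq_integral => //; apply: filterS aeq => z h _.
  by rewrite -exprMn h expr0n.
have m2 (v : R -> R) : measurable_fun [set: R] v ->
    measurable_fun [set: R] (fun x => (v x ^+ 2)%:E).
  by move=> mv; apply/measurable_EFinP; exact: measurable_funX.
rewrite (@fubini_tonelli1 _ _ _ _ R mu mu)//; first last.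
- by move=> z; rewrite lee_fin mulr_ge0 ?sqr_ge0.
- apply/measurable_EFinP; apply: measurable_funM; apply: measurable_funX;
    exact: measurableT_comp.
rewrite /fubini_F/=; under eq_integral => x _.
  under eq_integral => y _ do rewrite EFinM.
  rewrite ge0_integralZl_EFin//; last 3 first.
  - by move=> y _; rewrite lee_fin sqr_ge0.
  - exact: m2.
  - exact: sqr_ge0.
  rewrite -/(L2sq u) -L2sq_dot// muleC; over.
rewrite ge0_integralZl_EFin//; last 3 first.
- by move=> y _; rewrite lee_fin sqr_ge0.
- exact: m2.
- exact: dot_ge0.
rewrite -/(L2sq p) -L2sq_dot// -EFinM => -[/eqP].
by rewrite mulf_eq0 !gt_eqF.
Qed.

Lemma ae_dim_nonzero (E : set (R -> R)) n u : ae_dim E n -> E u -> ~ ae_zero u ->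
  (0 < n)%N.
Proof.
move=> [e [_ _ span]] Eu nu; rewrite lt0n; apply/eqP => n0; subst n.
have [a] := span u Eu; apply: contra_not nu.
by apply: (@filterS _ _ ae_filter) => x; rewrite big_ord0 subr0.
Qed.

Lemma ae_dim_witness (E : set (R -> R)) n : ae_dim E n -> (0 < n)%N ->
  exists2 u, E u & ~ ae_zero u.
Proof.
case: n => // n [e [Ee free _]] _; exists (e ord0) => // z0.
have hz : ae_zero (fun x => \sum_(i < n.+1) (i == ord0)%:R * e i x).
  apply: (@filterS _ _ ae_filter _ _ _ z0) => x h0.
  by rewrite big_ord_recl eqxx mul1r h0 add0r big1// => i _; rewrite mul0r.
by have /eqP := free _ hz ord0; rewrite eqxx oner_eq0.
Qed.

Lemma eigenspaceP V (l : R) u : frac_eigenspace 2^-1 `]-1, 1[ V l u <->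
  H12 R u /\ forall w, H12 R w -> form V u w = l * dot u w.
Proof. by []. Qed.

Lemma eigen_orth V (l l' : R) u v : bounded_potential V -> l != l' ->
  frac_eigenspace 2^-1 `]-1, 1[ V l u -> frac_eigenspace 2^-1 `]-1, 1[ V l' v ->
  dot u v = 0.
Proof.
move=> bV ll /eigenspaceP[Hu eu] /eigenspaceP[Hv ev].
have := eu _ Hv; rewrite (bilin_form bV).1 ev// (dot_sym v u) => /eqP.
by rewrite -subr_eq0 -mulrBl mulf_eq0 subr_eq0 eq_sym (negbTE ll) => /eqP.
Qed.

Lemma dim1_orth V (l : R) u v : ae_dim (frac_eigenspace 2^-1 `]-1, 1[ V l) 1 ->
  frac_eigenspace 2^-1 `]-1, 1[ V l u -> frac_eigenspace 2^-1 `]-1, 1[ V l v ->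
  dot u v = 0 -> 0 < dot u u -> 0 < dot v v -> False.
Proof.
move=> [e [_ _ span]] Eu Ev uv u2 v2; have Hu := Eu.1; have Hv := Ev.1.
have [a ua] := span _ Eu; have [b vb] := span _ Ev.
have Hw := H12_lin (b ord0) (- a ord0) Hu Hv.
have : ae_zero (lin (b ord0) u (- a ord0) v).
  apply: (@filterS2 _ _ ae_filter _ _ _ _ ua vb) => x; rewrite !big_ord1 => /subr0_eq h1 /subr0_eq h2.
  by rewrite /lin h1 h2; ring.
move/(ae_zeroP Hw); rewrite (bilin_quad _ _ bilin_dot)// uv mulr0 addr0 sqrrN => h.
have a0 : a ord0 = 0.
  apply/eqP; rewrite -sqrf_eq0 -[_ == 0](mulIr_eq0 _ (mulIf (lt0r_neq0 v2))) eq_le.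
  have := sqr_ge0 (a ord0); have := mulr_ge0 (sqr_ge0 (b ord0)) (ltW u2) => h1 h2.
  by rewrite (mulr_ge0 h2 (ltW v2)) andbT; lra.
have : ae_zero u.
  apply: (@filterS _ _ ae_filter _ _ _ ua) => x.
  by rewrite big_ord1 a0 mul0r subr0.
by move/(ae_zeroP Hu) => u0; rewrite u0 ltxx in u2.
Qed.

(** The first eigenvalue is the unconstrained minimum [m].  Minimising orthogonally
to the first minimiser gives another negative eigenvalue [m2].  If the second
eigenvalue were nonnegative, then [m2 = m] would be listed once, against the
presence of two orthogonal eigenfunctions. *)
Lemma second_negative V (lam : nat -> R) : bounded_potential V ->
  (forall f, H12 R f -> exists w,
     [/\ H12 R w, dot w f = 0, 0 < dot w w & form V w w < 0]) ->
  eigenvalue_sequence 2^-1 `]-1, 1[ V lam ->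
  lam 1%N < 0 /\ exists p, [/\ frac_eigenspace 2^-1 `]-1, 1[ V (lam 0%N) p,
    0 < dot p p & forall x, 0 <= p x].
Proof.
move=> bV neg [lam01 mono _ mult].
have bF := bilin_form bV.
have nz u : H12 R u -> 0 < dot u u -> ~ ae_zero u.
  by move=> Hu u2 /(ae_zeroP Hu) u0; rewrite u0 ltxx in u2.
have occurs l u : frac_eigenspace 2^-1 `]-1, 1[ V l u -> 0 < dot u u ->
    exists k, lam k = l.
  move=> Eu u2; have [n ln dn] := mult l.
  have n0 := ae_dim_nonzero dn Eu (nz _ Eu.1 u2).
  have : [set k | lam k = l] !=set0.
    apply/set0P/negP => /eqP s0; move: ln; rewrite s0 => /card_esym.
    rewrite card_eq0 => /eqP h; have : `I_n 0%N by [].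
    by rewrite h.
  by move=> [k kl]; exists k.
have bilin0 (F : (R -> R) -> (R -> R) -> R) w : bilin F -> H12 R w -> F (fun=> 0) w = 0.
  move=> [_ l] Hw; rewrite (_ : (fun=> 0) = lin 0 w 0 w).
    by rewrite l// !mul0r addr0.
  by apply/funext => x; rewrite /lin !mul0r addr0.
have H0 := @H12_zero R.
have neg0 : exists w, [/\ H12 R w, dot w (fun=> 0) = 0 & 0 < dot w w].
  by have [w [Hw w0 w2 _]] := neg _ H0; exists w.
have f0 w : H12 R w -> form V (fun=> 0) w = 0 * dot (fun=> 0) w.
  by move=> Hw; rewrite mul0r bilin0.
have [m [u1 [E1 _ d1 min1]]] := spectral_minimum bV H0 f0 neg0.
have H1 := E1.1.
have min w : H12 R w -> m * dot w w <= form V w w.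
  by move=> Hw; apply: min1 => //; rewrite dot_sym (bilin0 _ _ bilin_dot).
have [k0 lk0] := occurs _ _ E1 d1.
have lam0 : lam 0%N = m.
  apply/eqP; rewrite eq_le -{1}lk0 mono//=.
  have [n ln dn] := mult (lam 0%N).
  have n0 : (0 < n)%N.
    rewrite lt0n; apply/eqP => n0; move: ln; rewrite n0 II0 card_eq0 => /eqP h.
    by have : [set k | lam k = lam 0%N] 0%N by []; rewrite h.
  have [p Ep np] := ae_dim_witness dn n0.
  have Hp := Ep.1; have p2 : 0 < dot p p.
    by rewrite lt_neqAle dot_ge0 andbT eq_sym; apply/eqP => /(ae_zeroP Hp).
  have := min _ Hp; have -> : form V p p = lam 0%N * dot p p by exact: Ep.2.
  by rewrite ler_pM2r.
split.
  rewrite ltNge; apply/negP => lam1.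
  have [m2 [u2 [E2 o12 d2 min2]]] := spectral_minimum bV H1 E1.2 (let: ex_intro w (And4 Hw wf w2 _) := neg _ H1 in ex_intro _ w (And3 Hw wf w2)).
  have m20 : m2 < 0.
    have [w [Hw wf w2 wn]] := neg _ H1.
    have := le_lt_trans (min2 _ Hw wf) wn; by rewrite pmulr_llt0.
  have only0 k : lam k < 0 -> k = 0%N.
    by case: k => // k; rewrite ltNge (le_trans lam1)// mono.
  have [k2 lk2] := occurs _ _ E2 d2.
  have m2E : m2 = m by rewrite -lam0 -lk2 (only0 k2)// lk2.
  have [n ln dn] := mult m.
  have n1 : n = 1%N.
    apply/card_eq_II/(card_eq_trans (card_esym ln)).
    rewrite (_ : [set k | lam k = m] = `I_1)//.
    apply/seteqP; split => k /=.
      by move=> lk; rewrite (only0 k)// lk -m2E.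
    by case: k => // _; rewrite lam0.
  rewrite n1 in dn; rewrite m2E in E2.
  by apply: (dim1_orth dn E2 E1 o12).
(* The absolute value is again a minimiser, hence a null vector of the
   semidefinite form D. *)
exists (absf u1); rewrite lam0; split; last by move=> x; rewrite /absf.
  apply/eigenspaceP; have Ha := H12_abs H1; split => // w Hw.
  pose D u v := 1 * form V u v + (- m) * dot u v.
  have bD : bilin D by apply: bilin_comb => //; exact: bilin_dot.
  suff : D (absf u1) w = 0 by rewrite /D; lra.
  apply: (@psd_null _ D (H12 R) _ _ bD) => //.
  - by move=> *; exact: H12_lin.
  - by move=> v Hv; have := min _ Hv; rewrite /D; lra.
  - have := form_abs V H1; rewrite /D dot_abs.
    have -> : form V u1 u1 = m * dot u1 u1 by exact: E1.2.
    lra.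
by rewrite dot_abs.
Qed.

(** On the half-line [0 <= x < 1] both signs occur, and the sign at the farther of
two such points is repeated at its mirror image. *)
Lemma even_two_changes u : (forall x, u (- x) = u x) ->
  (exists2 y, I y & 0 < u y) -> (exists2 z, I z & u z < 0) ->
  exists2 v : R -> R, v = u \/ v = - u & exists y1 y2 y3 : R,
    [/\ -1 < y1, y1 < y2, y2 < y3 & y3 < 1] /\ [/\ v y1 < 0, 0 < v y2 & v y3 < 0].
Proof.
move=> uev.
have uabs x : u `|x| = u x.
  by have [x0|x0] := leP 0 x; [rewrite ger0_norm|rewrite ltr0_norm// uev].
have Iabs x : I x -> 0 <= `|x| < 1 by rewrite /= in_itv/= -ltr_norml normr_ge0.
move=> [y /Iabs/andP[y0 y1] uy] [z /Iabs/andP[z0 z1] uz].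
rewrite -uabs in uy; rewrite -uabs in uz.
move: `|y| `|z| y0 y1 uy z0 z1 uz => {}y {}z y0 y1 uy z0 z1 uz.
have [yz|zy|yz] := ltgtP y z.
- exists u; first by left.
  exists (- z), y, z; split; last by rewrite uev.
  by split; lra.
- exists (- u); first by right.
  exists (- y), z, y; split; first by split; lra.
  by rewrite /= -![(- u) _]/(- u _) uev !oppr_lt0 oppr_gt0.
- by rewrite yz in uy; have := lt_trans uy uz; rewrite ltxx.
Qed.

End Signs.

Theorem mainTheorem1 (R : realType) :
  exists V : R -> R,
    [/\ measurable_fun (`]-1, 1[ : set R) V,
        (exists M : R, forall x, x \in `]-1, 1[ -> `|V x| <= M)
      & forall (lam : nat -> R) (u : R -> R),
          eigenvalue_sequence 2^-1 `]-1, 1[ V lam ->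
          frac_eigenfunction 2^-1 `]-1, 1[ V (lam 1%N) u ->
          continuous u ->
          exists2 v : R -> R, v = u \/ v = - u &
            exists y1 y2 y3 : R,
              [/\ -1 < y1, y1 < y2, y2 < y3 & y3 < 1] /\
              [/\ v y1 < 0, 0 < v y2 & v y3 < 0]].
Proof.
have [e [e0 neg]] := @negative_orth R.
have bV := bdd_well e0; exists (well e); split.
- exact: bV.1.
- by exists (c_frac 2^-1 / e) => x _; exact: well_le.
move=> lam u seq [Eu nu] cu.
have [lam1 [p [Ep p2 p0]]] := second_negative bV neg seq.
have [lam01 _ _ _] := seq.
have Hu := Eu.1; have u2 : 0 < dot u u.
  by rewrite lt_neqAle dot_ge0 andbT eq_sym; apply/eqP => /(ae_zeroP Hu).
have uev x : u (- x) = u x.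
  apply/esym/subr0_eq; apply: (continuous_ae_zero _ (negative_even e0 lam1 Eu)).
  move=> y; apply: cvgB; first exact: cu.
  by apply: continuous_comp; [exact: opp_continuous|exact: cu].
have pu : dot p u = 0 by apply: (eigen_orth bV _ Ep Eu); rewrite lt_eqF.
(* Applied with s = 1 and s = -1, to exclude either constant sign. *)
have signed (s : R) : s != 0 -> (forall x, x \in `]-1, 1[ -> 0 <= s * u x) -> False.
  move=> s0 su; have Hs := H12_lin s 0 Hu Hu.
  have psu : dot p (lin s u 0 u) = 0.
    by rewrite (bilin_r _ _ (@bilin_dot R)) ?pu ?mulr0 ?addr0//; exact: Ep.1.
  apply: (@no_orthogonal_signed R (well e) (lam 0%N) (lin s u 0 u) p bV Hs Ep.1 _ p0 psu) => //.
  - by move=> x Ix; rewrite /lin mul0r addr0 su.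
  - exact: Ep.2.
  - rewrite (bilin_quad _ _ (@bilin_dot R))// mulr0 !mul0r expr0n mul0r !addr0.
    by rewrite mulr_gt0// exprn_even_gt0//= s0.
apply: even_two_changes => //.
- apply: contrapT => h; apply: (signed (-1)); first by rewrite oppr_eq0 oner_eq0.
  move=> x xI; rewrite mulN1r oppr_ge0 leNgt; apply/negP => ux.
  by apply: h; exists x.
- apply: contrapT => h; apply: (signed 1); first exact: oner_neq0.
  move=> x xI; rewrite mul1r leNgt; apply/negP => ux.
  by apply: h; exists x.
Qed.
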